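(* ($\mathsf{CZF}$) The Kripke model $K$ of hereditarily eventually constant Kripke sets over the frame $(\omega,\le)$ validates $\mathsf{ADCom}$.
   Context: The logic is intuitionistic. $\mathsf{CZF}$ has axioms Extensionality, Pairing, Union, Infinity, the $\in$-Induction scheme, $\Delta_0$-Separation, Strong Collection (if $\forall x\in a\,\exists y\,\phi(x,y)$ then there is a set $b$ with $\forall x\in a\,\exists y\in b\,\phi(x,y)$ and $\forall y\in b\,\exists x\in a\,\phi(x,y)$), and Subset Collection (for all sets $a,b$ there is a set $c$ such that for all $u$, if $\forall x\in a\,\exists y\in b\,\phi(x,y,u)$ then there is $d\in c$ with $\forall x\in a\,\exists y\in d\,\phi(x,y,u)$ and $\forall y\in d\,\exists x\in a\,\phi(x,y,u)$). $\mathsf{ADCom}$ (Axiom of Anti-Double Complement): $\forall x\,\bigl[\exists y\,\forall z\,(\neg\neg(z\in x)\to z\in y)\ \to\ x\subseteq 1\bigr]$, where $1=\{\varnothing\}$. Kripke sets over $\omega$: write $\uparrow p=\{q\in\omega\mid q\ge p\}$. For an ordinal $\alpha$ and $p\in\omega$, $V^\omega_\alpha(p)$ is inductively defined as the class of all functions $x$ with domain $\uparrow p$ such that $x(q)\subseteq\bigcup_{\beta\in\alpha}V^\omega_\beta(q)$ for all $q\ge p$, and $\tau_{qr}''[x(q)]\subseteq x(r)$ for all $p\le q\le r$, where $\tau_{qr}(y)=y\upharpoonright(\uparrow r)$ for $y$ with domain $\uparrow q$. $V^\omega(p)=\bigcup_{\alpha\in\mathrm{Ord}} V^\omega_\alpha(p)$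 and $V^\omega=\bigcup_p V^\omega(p)$. For $m\in\omega$ let $K^m$ be the least class such that $x\in K^m$ whenever there is a set $a\subseteq K^m$ with: (1) $x\in V^\omega$; (2) $x(p)\subseteq a$ for all $p\in\mathrm{dom}\,x$; (3) for all $q\ge p\ge m$ with $p,q\in\mathrm{dom}\,x$, $x(q)=\tau_{pq}''[x(p)]$. Put $K^m(p)=\{x\in K^m\mid\mathrm{dom}\,x=\uparrow p\}$ and $K(p)=\bigcup_{m\in\omega}K^m(p)$. Forcing over $K$, for parameters in $K(p)$: $p\Vdash_K x\in y$ iff $x\in y(p)$; $p\Vdash_K x=y$ iff $x(q)=y(q)$ for all $q\ge p$; $p\Vdash_K\phi\land\psi$ iff $p\Vdash_K\phi$ and $p\Vdash_K\psi$; $p\Vdash_K\phi\lor\psi$ iff $p\Vdash_K\phi$ or $p\Vdash_K\psi$; $p\Vdash_K\phi\to\psi$ iff for each $q\ge p$, $q\Vdash_K\phi$ implies $q\Vdash_K\psi$; $p\Vdash_K\forall x\,\phi(x)$ iff $q\Vdash_K\phi(x)$ for all $q\ge p$ and $x\in K(q)$; $p\Vdash_K\exists x\,\phi(x)$ iff $p\Vdash_K\phi(x)$ for some $x\in K(p)$; no $p$ forces falsum and $\neg\phi$ is $\phi\to$ falsum. A parameter $a\in K(r)$ with $r\le q$ is read at node $q$ as $\tau_{rq}(a)$. $K$ validates a sentence if $0\Vdash_K$ it. *)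

(* Defs.v *)
From Stdlib Require Import List Arith.
Import ListNotations.

(* The claim is a theorem OF CZF, so it is stated as derivability in
   intuitionistic first-order logic with equality from the axioms of CZF.
   Formulas of the language {mem, =} are raw de Bruijn terms; the language has
   no function symbols, so substitutions are renamings [nat -> nat]. *)

Inductive form : Type :=
| fBot : form
| fMem : nat -> nat -> form
| fEq  : nat -> nat -> form
| fAnd : form -> form -> form
| fOr  : form -> form -> form
| fImp : form -> form -> form
| fAll : form -> form
| fEx  : form -> form.

Definition scons (x : nat) (s : nat -> nat) (i : nat) : nat :=
  match i with 0 => x | S j => s j end.

Definition up (s : nat -> nat) : nat -> nat := scons 0 (fun i => S (s i)).

Fixpoint ren (s : nat -> nat) (phi : form) : form :=
  match phi with
  | fBot => fBot
  | fMem i j => fMem (s i) (s j)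
  | fEq i j => fEq (s i) (s j)
  | fAnd a b => fAnd (ren s a) (ren s b)
  | fOr a b => fOr (ren s a) (ren s b)
  | fImp a b => fImp (ren s a) (ren s b)
  | fAll a => fAll (ren (up s) a)
  | fEx a => fEx (ren (up s) a)
  end.

Definition shift : form -> form := ren S.
Definition subst0 (x : nat) : form -> form := ren (scons x (fun i => i)).

(* Intuitionistic natural deduction. An axiom of [T] with free variables
   may be used in any context without eigenvariable restrictions, i.e. it
   stands for its universal closure. *)
Inductive prv (T : form -> Prop) : list form -> form -> Prop :=
| prv_ax G a : T a -> prv T G a
| prv_hyp G a : In a G -> prv T G a
| prv_botE G a : prv T G fBot -> prv T G a
| prv_andI G a b : prv T G a -> prv T G b -> prv T G (fAnd a b)
| prv_andE1 G a b : prv T G (fAnd a b) -> prv T G a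
| prv_andE2 G a b : prv T G (fAnd a b) -> prv T G b
| prv_orI1 G a b : prv T G a -> prv T G (fOr a b)
| prv_orI2 G a b : prv T G b -> prv T G (fOr a b)
| prv_orE G a b c :
    prv T G (fOr a b) -> prv T (a :: G) c -> prv T (b :: G) c -> prv T G c
| prv_impI G a b : prv T (a :: G) b -> prv T G (fImp a b)
| prv_impE G a b : prv T G (fImp a b) -> prv T G a -> prv T G b
| prv_allI G a : prv T (map shift G) a -> prv T G (fAll a)
| prv_allE G a x : prv T G (fAll a) -> prv T G (subst0 x a)
| prv_exI G a x : prv T G (subst0 x a) -> prv T G (fEx a)
| prv_exE G a c :
    prv T G (fEx a) -> prv T (a :: map shift G) (shift c) -> prv T G c
| prv_eqI G x : prv T G (fEq x x)
| prv_eqE G x y a :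
    prv T G (fEq x y) -> prv T G (subst0 x a) -> prv T G (subst0 y a).

(* To write formulas with ordinary binders, a formula is built as a function
   of the current quantifier depth [n]. A bound variable is represented by the
   depth at which it was bound (its de Bruijn level), so its index at depth [n]
   is [n - S x]; an index [n + j] at depth [n] is the free variable [j] of the
   whole formula. *)
Definition hform : Type := nat -> form.

Definition hclose (f : hform) : form := f 0.

Definition hbot : hform := fun _ => fBot.
Definition hmem (x y : nat) : hform := fun n => fMem (n - S x) (n - S y).
Definition heq (x y : nat) : hform := fun n => fEq (n - S x) (n - S y).
Definition hand (f g : hform) : hform := fun n => fAnd (f n) (g n).
Definition hor (f g : hform) : hform := fun n => fOr (f n) (g n).
Definition himp (f g : hform) : hform := fun n => fImp (f n) (g n).
Definition hall (f : nat -> hform) : hform := fun n => fAll (f n (S n)).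
Definition hex (f : nat -> hform) : hform := fun n => fEx (f n (S n)).

(* [inst phi [x0; ..; xk]] is phi(x0, .., xk): the indices 0..k of [phi] are
   replaced by the listed variables, and its remaining free variables become
   free variables (set parameters) of the whole formula. *)
Definition inst (phi : form) (xs : list nat) : hform := fun n =>
  ren (fun i => match nth_error xs i with
                | Some x => n - S x
                | None => n + (i - length xs)
                end) phi.

Declare Scope hform_scope.
Delimit Scope hform_scope with H.
Bind Scope hform_scope with hform.

Notation "⊥" := hbot : hform_scope.
Notation "x ∈ y" := (hmem x y) (at level 70) : hform_scope.
Notation "x ≐ y" := (heq x y) (at level 70) : hform_scope.
Notation "f ∧ g" := (hand f%H g%H) (at level 80, right associativity) : hform_scope.
Notation "f ∨ g" := (hor f%H g%H) (at level 85, right associativity) : hform_scope.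
Notation "f ⇒ g" := (himp f%H g%H) (at level 90, right associativity) : hform_scope.
Notation "f ⇔ g" := (hand (himp f%H g%H) (himp g%H f%H)) (at level 95, no associativity)
  : hform_scope.
Notation "¬ f" := (himp f%H hbot) (at level 75, right associativity) : hform_scope.
Notation "∀ x .. y , f" := (hall (fun x => .. (hall (fun y => f%H)) ..))
  (at level 200, x binder, y binder, right associativity) : hform_scope.
Notation "∃ x .. y , f" := (hex (fun x => .. (hex (fun y => f%H)) ..))
  (at level 200, x binder, y binder, right associativity) : hform_scope.
Notation "∀' x ∈ a , f" := (hall (fun x => himp (hmem x a) f%H))
  (at level 200, x name, a at level 69, right associativity) : hform_scope.
Notation "∃' x ∈ a , f" := (hex (fun x => hand (hmem x a) f%H))
  (at level 200, x name, a at level 69, right associativity) : hform_scope.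

Local Open Scope hform_scope.

Definition is_empty (e : nat) : hform := ∀ w, ¬ (w ∈ e).

(* y = x ∪ {x} *)
Definition is_succ (x y : nat) : hform := ∀ z, z ∈ y ⇔ (z ∈ x ∨ z ≐ x).

(* c = {a, b} *)
Definition is_upair (a b c : nat) : hform := ∀ u, u ∈ c ⇔ (u ≐ a ∨ u ≐ b).

(* w = {0} ∪ {v + 1 | v ∈ w}; by ∈-induction there is only one such set *)
Definition is_omega (w : nat) : hform :=
  ∀ u, u ∈ w ⇔ (is_empty u ∨ ∃' v ∈ w, is_succ v u).

Inductive Delta0 : form -> Prop :=
| D0_bot : Delta0 fBot
| D0_mem i j : Delta0 (fMem i j)
| D0_eq i j : Delta0 (fEq i j)
| D0_and a b : Delta0 a -> Delta0 b -> Delta0 (fAnd a b)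
| D0_or a b : Delta0 a -> Delta0 b -> Delta0 (fOr a b)
| D0_imp a b : Delta0 a -> Delta0 b -> Delta0 (fImp a b)
| D0_ball i a : Delta0 a -> Delta0 (fAll (fImp (fMem 0 (S i)) a))
| D0_bex i a : Delta0 a -> Delta0 (fEx (fAnd (fMem 0 (S i)) a)).

Definition Extensionality : hform :=
  ∀ a b, (∀ x, x ∈ a ⇔ x ∈ b) ⇒ a ≐ b.
Definition Pairing : hform := ∀ a b, ∃ c, is_upair a b c.
Definition Union : hform := ∀ a, ∃ b, ∀ x, x ∈ b ⇔ (∃' y ∈ a, x ∈ y).
Definition Infinity : hform := ∃ w, is_omega w.
Definition mem_induction (phi : form) : hform :=
  (∀ x, (∀' y ∈ x, inst phi [y]) ⇒ inst phi [x]) ⇒ ∀ x, inst phi [x].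
Definition separation (phi : form) : hform :=
  ∀ a, ∃ b, ∀ x, x ∈ b ⇔ (x ∈ a ∧ inst phi [x]).
Definition strong_collection (phi : form) : hform :=
  ∀ a, (∀' x ∈ a, ∃ y, inst phi [x; y]) ⇒
    ∃ b, (∀' x ∈ a, ∃' y ∈ b, inst phi [x; y]) ∧
         (∀' y ∈ b, ∃' x ∈ a, inst phi [x; y]).
Definition subset_collection (phi : form) : hform :=
  ∀ a b, ∃ c, ∀ u, (∀' x ∈ a, ∃' y ∈ b, inst phi [x; y; u]) ⇒
    ∃' d ∈ c, (∀' x ∈ a, ∃' y ∈ d, inst phi [x; y; u]) ∧
             (∀' y ∈ d, ∃' x ∈ a, inst phi [x; y; u]).

Inductive CZF : form -> Prop :=
| CZF_ext : CZF (hclose Extensionality)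
| CZF_pair : CZF (hclose Pairing)
| CZF_union : CZF (hclose Union)
| CZF_inf : CZF (hclose Infinity)
| CZF_mem_ind phi : CZF (hclose (mem_induction phi))
| CZF_sep phi : Delta0 phi -> CZF (hclose (separation phi))
| CZF_scoll phi : CZF (hclose (strong_collection phi))
| CZF_subcoll phi : CZF (hclose (subset_collection phi)).

Definition CZF_proves (f : hform) : Prop := prv CZF [] (hclose f).

(** Kripke sets over ω *)

Definition in_omega (n : nat) : hform := ∃ w, is_omega w ∧ n ∈ w.

Definition le_omega (p q : nat) : hform := p ∈ q ∨ p ≐ q.

(* q ∈ ↑p *)
Definition in_up (p q : nat) : hform := in_omega q ∧ le_omega p q.

(* z = (x, y), the Kuratowski pair {{x}, {x, y}} *)
Definition is_opair (x y z : nat) : hform :=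
  ∀ u, u ∈ z ⇔ (is_upair x x u ∨ is_upair x y u).

Definition is_function (f : nat) : hform :=
  (∀' z ∈ f, ∃ x y, is_opair x y z) ∧
  (∀ x y y' z z', z ∈ f ∧ is_opair x y z ∧ z' ∈ f ∧ is_opair x y' z' ⇒ y ≐ y').

(* (q, v) ∈ f, i.e. f(q) = v for a function f *)
Definition has_value (f q v : nat) : hform := ∃' z ∈ f, is_opair q v z.

Definition in_dom (f q : nat) : hform := ∃ v, has_value f q v.

(* dom f = ↑p *)
Definition dom_is_up (f p : nat) : hform := ∀ q, in_dom f q ⇔ in_up p q.

(* y' = y ↾ (↑r); this is τ_{qr}(y) when dom y = ↑q *)
Definition is_restr (r y y' : nat) : hform :=
  ∀ z, z ∈ y' ⇔ (z ∈ y ∧ ∃ s v, in_up r s ∧ is_opair s v z).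

Definition is_transitive (a : nat) : hform := ∀' x ∈ a, ∀' y ∈ x, y ∈ a.
Definition is_ordinal (a : nat) : hform :=
  is_transitive a ∧ ∀' x ∈ a, is_transitive x.

(* Classes are formulas. [nu] is a formula nu(α, p, x), meant to define
   x ∈ V^ω_α(p), and [kappa] a formula kappa(m, x), meant to define x ∈ K^m.
   CZF has such formulas by its class inductive definition theorem; the
   predicates [defines_V] and [defines_K] say that they define these classes. *)

(* The right-hand side of the recursion for x ∈ V^ω_α(p). *)
Definition V_step (nu : form) (alpha p x : nat) : hform :=
  is_function x ∧ dom_is_up x p ∧
  (∀ q xq, in_up p q ∧ has_value x q xq ⇒
     ∀' y ∈ xq, ∃' beta ∈ alpha, inst nu [beta; q; y]) ∧
  (∀ q r xq xr, in_up p q ∧ in_up q r ∧ has_value x q xq ∧ has_value x r xr ⇒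
     ∀' y ∈ xq, ∀ y', is_restr r y y' ⇒ y' ∈ xr).

Definition defines_V (nu : form) : Prop :=
  CZF_proves (∀ alpha p x, is_ordinal alpha ∧ in_omega p ⇒
                (inst nu [alpha; p; x] ⇔ V_step nu alpha p x)).

(* x ∈ V^ω *)
Definition in_V (nu : form) (x : nat) : hform :=
  ∃ p alpha, in_omega p ∧ is_ordinal alpha ∧ inst nu [alpha; p; x].

(* Conditions (1)-(3) on x and the set a in the definition of K^m. *)
Definition K_step (nu : form) (m x a : nat) : hform :=
  in_V nu x ∧
  (∀ p xp, has_value x p xp ⇒ ∀' y ∈ xp, y ∈ a) ∧
  (∀ p q xp xq, has_value x p xp ∧ has_value x q xq ∧
                le_omega m p ∧ le_omega p q ⇒
     ∀ y, y ∈ xq ⇔ (∃' u ∈ xp, is_restr q u y)).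

(* The class {x | phi(m, x)} contains x whenever it includes a set a as in the
   definition of K^m. *)
Definition K_closed (nu phi : form) (m : nat) : hform :=
  ∀ x a, (∀' y ∈ a, inst phi [m; y]) ∧ K_step nu m x a ⇒ inst phi [m; x].

(* K^m is the least class closed in this sense, for each m ∈ ω; leastness is a
   schema over all classes {x | phi(m, x)}, where [phi] may have parameters. *)
Definition defines_K (nu kappa : form) : Prop :=
  CZF_proves (∀ m, in_omega m ⇒ K_closed nu kappa m) /\
  forall phi : form,
    CZF_proves (∀ m, in_omega m ⇒ K_closed nu phi m ⇒
                  ∀ x, inst kappa [m; x] ⇒ inst phi [m; x]).

(* x ∈ K(p) *)
Definition in_K (kappa : form) (p x : nat) : hform :=
  ∃ m, in_omega m ∧ inst kappa [m; x] ∧ dom_is_up x p.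

(* [forces kappa phi p e] is the formula p ⊩_K phi, where variable i of [phi]
   denotes the parameter e(i). Parameters stay in the K(r) they come from and
   are restricted to ↑p where they are used, in the atomic clauses. *)
Fixpoint forces (kappa : form) (phi : form) (p : nat) (e : nat -> nat) : hform :=
  match phi with
  | fBot => ⊥
  | fMem i j =>
      ∃ x y, is_restr p (e i) x ∧ is_restr p (e j) y ∧
             ∃ yp, has_value y p yp ∧ x ∈ yp
  | fEq i j =>
      ∃ x y, is_restr p (e i) x ∧ is_restr p (e j) y ∧
             ∀ q, in_up p q ⇒ ∃ v, has_value x q v ∧ has_value y q v
  | fAnd a b => forces kappa a p e ∧ forces kappa b p e
  | fOr a b => forces kappa a p e ∨ forces kappa b p e
  | fImp a b => ∀ q, in_up p q ⇒ forces kappa a q e ⇒ forces kappa b q e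
  | fAll a => ∀ q, in_up p q ⇒ ∀ x, in_K kappa q x ⇒ forces kappa a q (scons x e)
  | fEx a => ∃ x, in_K kappa p x ∧ forces kappa a p (scons x e)
  end.

(* 0 ⊩_K sigma, for a sentence sigma (so the initial environment is unused). *)
Definition K_validates (kappa sigma : form) : hform :=
  ∀ o, is_empty o ⇒ forces kappa sigma o (fun _ => o).

(* z ∈ {∅} is z = ∅, i.e. z has no element. *)
Definition ADCom : form := hclose
  (∀ x, (∃ y, ∀ z, ¬ ¬ (z ∈ x) ⇒ z ∈ y) ⇒ (∀ z, z ∈ x ⇒ is_empty z)).

(* Main.v *)
Require Import Defs.
From Stdlib Require Import List Arith Lia FunctionalExtensionality.
Import ListNotations.

(** Suppose that at some node [y ∈ K] contains every [z] whose membership in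
    [x] is not refuted, and that at a later node some [z ∈ x] has an element
    [w]; a contradiction is wanted. Let [y ∈ K^m]: all elements of [y] are then
    eventually constant from stage [m] on, however late one looks at [y]. Take a
    node [r] beyond everything mentioned so far, [m] included, and delay [z] by
    one step: let [z'(r) = ∅] and [z'(q) = z(q)] for [q > r]. Then

    - [z'] is a Kripke set with the same rank bound as [z] ([delayed_V]) and is
      constant from [r + 1] on, so it lies in [K] ([delayed_K]);
    - beyond [r] it agrees with [z], an element of [x], so its membership in [x]
      is doubly negated at [r] ([delayed_dense]), and [y] must contain it at [r];
    - it is not constant from [m] on, because it has no element at [r] but has
      the restriction of [w] at [r + 1] ([delayed_not_K]).

    So [z' ∈ y(r)] would be in [K^m] and not in [K^m]. What is used of the least
    class [K^m] is that it is inverted by its own generating step ([K_inv]) and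
    grows with [m] ([K_mono]).

    The theorem asserts a formal derivation. Instead of writing one, formulas are
    interpreted by sets of contexts: [G ⊩ p] is read as [p] holding in the
    context [G], the connectives are those of the complete Heyting algebra of
    upward closed sets of contexts that are stable under [covered], and the
    quantifiers range over all variable names, constantly in [G]. The completeness
    lemma [den_provable] says that the interpretation of a formula holds at [G]
    exactly if the formula is derivable from [G]; this rests on derivability being
    invariant under renaming of variables ([prv_ren]), so that a name outside the
    context can serve as a generic object. Set theory is then developed with
    statements [G ⊩ p] whose bound variables are bound variables of the
    metalanguage. A schema of CZF applies to the predicates that come from a
    formula, which are called [definable]. *)

(** * Renaming of variables in derivations *)

Lemma ren_ext (a : form) (s t : nat -> nat) :
  (forall i, s i = t i) -> ren s a = ren t a.
Proof. intros E; now rewrite (functional_extensionality _ _ E). Qed.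

Lemma ren_ren (a : form) : forall s t, ren t (ren s a) = ren (fun i => t (s i)) a.
Proof.
  induction a; intros s t; cbn; rewrite ?IHa1, ?IHa2; trivial;
    rewrite IHa; f_equal; apply ren_ext; now intros [|i].
Qed.

Lemma ren_id (a : form) : ren (fun i => i) a = a.
Proof.
  assert (U : forall i, up (fun i => i) i = i) by now intros [|i].
  induction a; cbn; try congruence;
    rewrite (ren_ext _ _ _ U); congruence.
Qed.

Lemma ren_subst0 (s : nat -> nat) (x : nat) (a : form) :
  ren s (subst0 x a) = subst0 (s x) (ren (up s) a).
Proof. unfold subst0; rewrite !ren_ren; apply ren_ext; now intros [|i]. Qed.

Lemma subst0_up (e : nat -> nat) (x : nat) (a : form) :
  subst0 x (ren (up e) a) = ren (scons x e) a.
Proof. unfold subst0; rewrite ren_ren; apply ren_ext; now intros [|i]. Qed.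

Lemma map_shift_ren (s : nat -> nat) (G : list form) :
  map (ren (up s)) (map shift G) = map shift (map (ren s) G).
Proof.
  rewrite !map_map; apply map_ext; intros a; unfold shift.
  rewrite !ren_ren; now apply ren_ext.
Qed.

(** Every free variable of a formula is below its bound, so a variable at or
    above the bound is fresh. *)
Fixpoint var_bound (a : form) : nat :=
  match a with
  | fBot => 0
  | fMem i j | fEq i j => Nat.max (S i) (S j)
  | fAnd a b | fOr a b | fImp a b => Nat.max (var_bound a) (var_bound b)
  | fAll a | fEx a => pred (var_bound a)
  end.

Lemma ren_bound (a : form) : forall s t,
  (forall i, i < var_bound a -> s i = t i) -> ren s a = ren t a.
Proof.
  induction a; intros s t E; cbn [ren var_bound] in *.
  1: reflexivity.
  1-2: f_equal; apply E; lia.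
  1-3: f_equal; [apply IHa1 | apply IHa2]; intros; apply E; lia.
  all: f_equal; apply IHa; intros [|i] L; [reflexivity|]; cbn; f_equal; apply E; cbn; lia.
Qed.

Definition ctx_bound (G : list form) : nat :=
  fold_right (fun a n => Nat.max (var_bound a) n) 0 G.

Lemma ctx_bound_in (G : list form) (a : form) : In a G -> var_bound a <= ctx_bound G.
Proof.
  induction G as [|b G IH]; [intros []|].
  change (ctx_bound (b :: G)) with (Nat.max (var_bound b) (ctx_bound G)).
  intros [->|I]; [|specialize (IH I)]; lia.
Qed.

(** Universal quantification of the variables [0, .., k - 1]. *)
Fixpoint alls (k : nat) (a : form) : form :=
  match k with 0 => a | S k => alls k (fAll a) end.

Lemma prv_alls (T : form -> Prop) (k : nat) : forall a,
  (forall G, prv T G a) -> forall G, prv T G (alls k a).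
Proof. induction k; cbn; intros a H G; auto using prv_allI. Qed.

Lemma prv_alls_inst (T : form -> Prop) (G : list form) (k : nat) : forall a s,
  prv T G (alls k a) ->
  prv T G (ren (fun i => if i <? k then s i else i - k) a).
Proof.
  induction k; intros a s H.
  - replace (ren _ a) with a; trivial.
    rewrite <- (ren_id a) at 1; apply ren_ext; intros i; cbn; lia.
  - specialize (IHk _ (fun i => s (S i)) H).
    apply prv_allE with (x := s 0) in IHk.
    rewrite subst0_up in IHk.
    erewrite ren_ext; [exact IHk|]; now intros [|i].
Qed.

(** The set of axioms need not be closed under renaming. But an axiom is
    available in every context, hence so is its universal closure, and this can
    be instantiated by the renamed variables. *)
Lemma prv_ax_ren (T : form -> Prop) (G : list form) (a : form) (s : nat -> nat) :
  T a -> prv T G (ren s a).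
Proof.
  intros H.
  assert (A : prv T G (alls (var_bound a) a)) by (apply prv_alls; auto using prv_ax).
  apply prv_alls_inst with (s := s) in A.
  erewrite ren_bound; [exact A|]. intros i L.
  apply Nat.ltb_lt in L; cbn beta; now rewrite L.
Qed.

Lemma prv_ren (T : form -> Prop) (G : list form) (a : form) :
  prv T G a -> forall s, prv T (map (ren s) G) (ren s a).
Proof.
  induction 1; intros s; cbn in *.
  - now apply prv_ax_ren.
  - apply prv_hyp; now apply in_map.
  - apply prv_botE; auto.
  - apply prv_andI; auto.
  - eapply prv_andE1; eauto.
  - eapply prv_andE2; eauto.
  - apply prv_orI1; auto.
  - apply prv_orI2; auto.
  - eapply prv_orE; eauto.
  - apply prv_impI; auto.
  - eapply prv_impE; eauto.
  - apply prv_allI. rewrite <- map_shift_ren; auto.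
  - rewrite ren_subst0; apply prv_allE; auto.
  - apply prv_exI with (x := s x); rewrite <- ren_subst0; auto.
  - eapply prv_exE; [eauto|].
    specialize (IHprv2 (up s)).
    rewrite map_shift_ren in IHprv2.
    replace (shift (ren s c)) with (ren (up s) (shift c)); trivial.
    unfold shift; rewrite !ren_ren; now apply ren_ext.
  - apply prv_eqI.
  - rewrite ren_subst0 in *. eapply prv_eqE; eauto.
    rewrite <- ren_subst0; auto.
Qed.

Lemma prv_weaken (T : form -> Prop) (G : list form) (a : form) :
  prv T G a -> forall G', incl G G' -> prv T G' a.
Proof.
  induction 1; intros G' I.
  - now apply prv_ax.
  - apply prv_hyp; auto.
  - apply prv_botE; auto.
  - apply prv_andI; auto.
  - eapply prv_andE1; eauto.
  - eapply prv_andE2; eauto.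
  - apply prv_orI1; auto.
  - apply prv_orI2; auto.
  - eapply prv_orE; [eauto| |]; [apply IHprv2|apply IHprv3];
      apply incl_cons; cbn; auto; now apply incl_tl.
  - apply prv_impI; apply IHprv; apply incl_cons; cbn; auto; now apply incl_tl.
  - eapply prv_impE; eauto.
  - apply prv_allI; apply IHprv; now apply incl_map.
  - apply prv_allE; auto.
  - eapply prv_exI; eauto.
  - eapply prv_exE; [eauto|]. apply IHprv2.
    apply incl_cons; cbn; auto; apply incl_tl; now apply incl_map.
  - apply prv_eqI.
  - eapply prv_eqE; eauto.
Qed.

(** Renaming by this function turns a derivation about a fresh name [y] into one
    about the variable 0, which the quantifier rules bind. *)
Definition abstract_var (y i : nat) : nat := if i =? y then 0 else S i.

Lemma abstract_shift (y : nat) (a : form) :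
  var_bound a <= y -> ren (abstract_var y) a = shift a.
Proof.
  intros L; apply ren_bound; intros i Li; unfold abstract_var.
  replace (i =? y) with false; trivial; symmetry; apply Nat.eqb_neq; lia.
Qed.

Lemma abstract_ctx (y : nat) (G : list form) :
  ctx_bound G <= y -> map (ren (abstract_var y)) G = map shift G.
Proof.
  intros L; apply map_ext_in; intros a I; apply abstract_shift.
  apply ctx_bound_in in I; lia.
Qed.

Lemma abstract_subst0 (y : nat) (a : form) :
  var_bound a <= y -> ren (abstract_var y) (subst0 y a) = a.
Proof.
  intros L; unfold subst0; rewrite ren_ren.
  transitivity (ren (fun i => i) a); [|apply ren_id].
  apply ren_bound; intros [|i] Li; cbn; unfold abstract_var.
  - now rewrite Nat.eqb_refl.
  - replace (i =? y) with false; trivial; symmetry; apply Nat.eqb_neq; lia.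
Qed.

(** Generalization without shifting the context: what holds for all names holds
    for a fresh one. *)
Lemma prv_allI_named (T : form -> Prop) (G : list form) (a : form) :
  (forall x, prv T G (subst0 x a)) -> prv T G (fAll a).
Proof.
  intros H. set (y := Nat.max (ctx_bound G) (var_bound a)).
  apply prv_allI. specialize (H y).
  apply prv_ren with (s := abstract_var y) in H.
  rewrite abstract_ctx, abstract_subst0 in H by lia. exact H.
Qed.

Lemma prv_exE_named (T : form -> Prop) (G : list form) (a c : form) :
  prv T G (fEx a) -> (forall x, prv T (subst0 x a :: G) c) -> prv T G c.
Proof.
  intros E H.
  set (y := Nat.max (Nat.max (ctx_bound G) (var_bound c)) (var_bound a)).
  apply (prv_exE _ _ _ _ E). specialize (H y).
  apply prv_ren with (s := abstract_var y) in H. cbn in H.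
  rewrite abstract_ctx, abstract_subst0, abstract_shift in H by lia. exact H.
Qed.

(** * Propositions as sets of contexts *)

(** [covered S G] says that the extensions of [G] in [S] cover [G]: a formula
    derivable in all of them is derivable in [G], and likewise above [G]. A
    disjunction covers where one of its sides holds, although neither side need
    hold at [G] itself. *)
Definition covered (S : list form -> Prop) (G : list form) : Prop :=
  forall G1, incl G G1 ->
  forall c, (forall G2, incl G1 G2 -> S G2 -> prv CZF G2 c) -> prv CZF G1 c.

(** Stability under covers makes case distinctions legitimate for every
    proposition as a goal, not only for those that come from formulas. *)
Record prop : Type := {
  holds : list form -> Prop;
  holds_mono G G' : incl G G' -> holds G -> holds G';
  holds_local G : covered holds G -> holds G }.

Declare Scope prop_scope.
Delimit Scope prop_scope with P.
Bind Scope prop_scope with prop.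
Notation "G ⊩ p" := (holds p%P G) (at level 99, p at level 200).

Lemma covered_mono (S : list form -> Prop) (G G' : list form) :
  incl G G' -> covered S G -> covered S G'.
Proof. intros I H G1 I1; apply H; eauto using incl_tran. Qed.

Lemma covered_local (S : list form -> Prop) (G : list form) :
  covered (covered S) G -> covered S G.
Proof.
  intros H G1 I1 c K. apply (H G1 I1). intros G2 I2 H2.
  apply (H2 G2 (incl_refl _)). intros G3 I3; apply K; eauto using incl_tran.
Qed.

Lemma covered_unit (S : list form -> Prop) (G : list form) :
  (forall G', incl G G' -> S G') -> covered S G.
Proof. intros H G1 I c K; apply K; auto using incl_refl. Qed.

(** The elimination principle behind disjunctions and existential quantifiers. *)
Lemma covered_elim (S : list form -> Prop) (G : list form) (p : prop) :
  covered S G -> (forall G', incl G G' -> S G' -> G' ⊩ p) -> G ⊩ p.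
Proof.
  intros H K; apply holds_local. intros G1 I1 c L.
  apply (H G1 I1); intros G2 I2 H2. apply (L G2 I2), K; eauto using incl_tran.
Qed.

Program Definition pAtom (a : form) : prop := {| holds G := prv CZF G a |}.
Next Obligation. eauto using prv_weaken. Qed.
Next Obligation. apply (H G (incl_refl G)); auto. Qed.

Program Definition pAnd (p q : prop) : prop :=
  {| holds G := holds p G /\ holds q G |}.
Next Obligation. split; eapply holds_mono; eauto. Qed.
Next Obligation.
  split; apply holds_local; intros G1 I c K; apply (H G1 I);
    intros G2 J [Hp Hq]; auto.
Qed.

Program Definition pImp (p q : prop) : prop :=
  {| holds G := forall G', incl G G' -> holds p G' -> holds q G' |}.
Next Obligation. eauto using incl_tran. Qed.
Next Obligation.
  eapply covered_elim; [exact (covered_mono _ _ _ H0 H)|].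
  cbn; intros G2 J Hpq; eauto using holds_mono, incl_refl.
Qed.

Program Definition pOr (p q : prop) : prop :=
  {| holds := covered (fun G => holds p G \/ holds q G) |}.
Next Obligation. eauto using covered_mono. Qed.
Next Obligation. auto using covered_local. Qed.

Program Definition pAll (f : nat -> prop) : prop :=
  {| holds G := forall x, holds (f x) G |}.
Next Obligation. eauto using holds_mono. Qed.
Next Obligation. eapply covered_elim; eauto. Qed.

Program Definition pEx (f : nat -> prop) : prop :=
  {| holds := covered (fun G => exists x, holds (f x) G) |}.
Next Obligation. eauto using covered_mono. Qed.
Next Obligation. auto using covered_local. Qed.

Definition pBot : prop := pAtom fBot.
Definition pMem (x y : nat) : prop := pAtom (fMem x y).
Definition pEq (x y : nat) : prop := pAtom (fEq x y).

Notation "⊥" := pBot : prop_scope.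
Notation "x ∈ y" := (pMem x y) (at level 70) : prop_scope.
Notation "x ≐ y" := (pEq x y) (at level 70) : prop_scope.
Notation "p ∧ q" := (pAnd p%P q%P) (at level 80, right associativity) : prop_scope.
Notation "p ∨ q" := (pOr p%P q%P) (at level 85, right associativity) : prop_scope.
Notation "p ⇒ q" := (pImp p%P q%P) (at level 90, right associativity) : prop_scope.
Notation "p ⇔ q" := (pAnd (pImp p%P q%P) (pImp q%P p%P)) (at level 95, no associativity)
  : prop_scope.
Notation "¬ p" := (pImp p%P pBot) (at level 75, right associativity) : prop_scope.
Notation "∀ x .. y , p" := (pAll (fun x => .. (pAll (fun y => p%P)) ..))
  (at level 200, x binder, y binder, right associativity) : prop_scope.
Notation "∃ x .. y , p" := (pEx (fun x => .. (pEx (fun y => p%P)) ..))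
  (at level 200, x binder, y binder, right associativity) : prop_scope.
Notation "∀' x ∈ a , p" := (pAll (fun x => pImp (pMem x a) p%P))
  (at level 200, x name, a at level 69, right associativity) : prop_scope.
Notation "∃' x ∈ a , p" := (pEx (fun x => pAnd (pMem x a) p%P))
  (at level 200, x name, a at level 69, right associativity) : prop_scope.

(** * Interpretation of formulas *)

(** By recursion only, so that for a concrete formula the interpretation is
    found by computation. *)
Fixpoint den (a : form) (e : nat -> nat) : prop :=
  match a with
  | fBot => ⊥
  | fMem i j => e i ∈ e j
  | fEq i j => e i ≐ e j
  | fAnd a b => den a e ∧ den b e
  | fOr a b => den a e ∨ den b e
  | fImp a b => den a e ⇒ den b e
  | fAll a => ∀ x, den a (scons x e)
  | fEx a => ∃ x, den a (scons x e)
  end.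

(** Soundness and completeness at once. In the case of implication the context
    can be extended by the premise, in the case of a quantifier a fresh name stands
    for an arbitrary object, and in the positive cases the formula itself is an
    instance of the conclusions that a cover quantifies over. *)
Lemma den_provable (a : form) : forall e G, (G ⊩ den a e) <-> prv CZF G (ren e a).
Proof.
  induction a; intros e G; cbn.
  1-3: reflexivity.
  - rewrite IHa1, IHa2; split.
    + intros []; now apply prv_andI.
    + split; [eapply prv_andE1 | eapply prv_andE2]; eauto.
  - split.
    + intros H; apply (H G (incl_refl G)); intros G' I [A|A].
      * apply prv_orI1, IHa1, A.
      * apply prv_orI2, IHa2, A.
    + intros H G1 I c K. eapply prv_orE; [exact (prv_weaken _ _ _ H _ I)| |].
      all: apply K; [now apply incl_tl, incl_refl|].
      * left; apply IHa1, prv_hyp; now left.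
      * right; apply IHa2, prv_hyp; now left.
  - split.
    + intros H; apply prv_impI, IHa2, H; [now apply incl_tl, incl_refl|].
      apply IHa1, prv_hyp; now left.
    + intros H G' I A. apply IHa2; eapply prv_impE; [exact (prv_weaken _ _ _ H _ I)|].
      now apply IHa1.
  - split.
    + intros H; apply prv_allI_named; intros x. rewrite subst0_up. apply IHa, H.
    + intros H x. apply IHa. rewrite <- subst0_up. now apply prv_allE.
  - split.
    + intros H; apply (H G (incl_refl G)); intros G' I [x A].
      apply prv_exI with (x := x). rewrite subst0_up. now apply IHa.
    + intros H G1 I c K. eapply prv_exE_named; [exact (prv_weaken _ _ _ H _ I)|].
      intros x; apply K; [now apply incl_tl, incl_refl|].
      exists x. apply IHa. rewrite <- subst0_up. apply prv_hyp; now left.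
Qed.

Lemma den_ren (a : form) : forall s e, den (ren s a) e = den a (fun i => e (s i)).
Proof.
  induction a; intros s e; cbn; rewrite ?IHa1, ?IHa2; trivial;
    f_equal; extensionality x; rewrite IHa; f_equal;
    extensionality i; now destruct i.
Qed.

(** A theorem holds in every context and for every assignment of its free
    variables, in particular when these are used as parameters. *)
Lemma den_valid (a : form) : prv CZF [] a -> forall e G, G ⊩ den a e.
Proof.
  intros H e G. apply den_provable. apply prv_ren with (s := e) in H.
  eapply prv_weaken; [exact H|]. intros ? [].
Qed.

Lemma leibniz (a : form) (e : nat -> nat) (x y : nat) (G : list form) :
  (G ⊩ x ≐ y) -> (G ⊩ den a (scons x e)) -> (G ⊩ den a (scons y e)).
Proof.
  rewrite !den_provable, <- !subst0_up. apply prv_eqE.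
Qed.

(** * Reasoning inside the interpretation *)

Lemma imp_intro (p q : prop) (G : list form) :
  (forall G', incl G G' -> (G' ⊩ p) -> (G' ⊩ q)) -> G ⊩ p ⇒ q.
Proof. trivial. Qed.

Lemma mp {p q : prop} {G : list form} :
  (G ⊩ p ⇒ q) -> (G ⊩ p) -> (G ⊩ q).
Proof. intros H; apply H, incl_refl. Qed.

Lemma bot_elim (p : prop) (G : list form) : (G ⊩ ⊥) -> (G ⊩ p).
Proof.
  intros H; apply holds_local; intros G1 I c _; apply prv_botE.
  exact (holds_mono ⊥ _ _ I H).
Qed.

Lemma or_left (p q : prop) (G : list form) : (G ⊩ p) -> (G ⊩ p ∨ q).
Proof. intros H; apply covered_unit; eauto using holds_mono. Qed.

Lemma or_right (p q : prop) (G : list form) : (G ⊩ q) -> (G ⊩ p ∨ q).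
Proof. intros H; apply covered_unit; eauto using holds_mono. Qed.

Lemma exists_intro (f : nat -> prop) (x : nat) (G : list form) :
  (G ⊩ f x) -> (G ⊩ ∃ x, f x).
Proof. intros H; apply covered_unit; eauto using holds_mono. Qed.

Lemma all_intro (f : nat -> prop) (G : list form) :
  (forall x, G ⊩ f x) -> G ⊩ ∀ x, f x.
Proof. trivial. Qed.

Lemma and_intro (p q : prop) (G : list form) :
  (G ⊩ p) -> (G ⊩ q) -> G ⊩ p ∧ q.
Proof. now split. Qed.

Lemma equal_refl (x : nat) (G : list form) : G ⊩ x ≐ x.
Proof. apply prv_eqI. Qed.

(** Moves all hypotheses along an extension [I] of the context and forgets the old
    context, so that a proof mentions one context only. *)
Ltac transport I :=
  lazymatch type of I with incl ?G ?G' =>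
    repeat match goal with
      | H : holds ?p G |- _ => apply (holds_mono p G G' I) in H
    end;
    clear I; try (clear G; rename G' into G)
  end.

Ltac head t := lazymatch t with ?f _ => head f | _ => t end.

(** Unfolds a defined proposition until its leading connective shows. *)
Ltac pnorm :=
  lazymatch goal with
  | |- holds (pAll _) _ => idtac
  | |- holds (pImp _ _) _ => idtac
  | |- holds (pAnd _ _) _ => idtac
  | |- holds ?p _ => let h := head p in unfold h; cbn beta; pnorm
  end.

Ltac pintro1 H :=
  pnorm;
  lazymatch goal with
  | |- holds (pAll _) _ => apply all_intro; intro H; cbn beta
  | |- holds (pImp _ _) _ =>
      apply imp_intro;
      let G' := fresh "G_" in let I := fresh "I_" in intros G' I H; transport I
  end.

Tactic Notation "pintro" ident(x) := pintro1 x.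
Tactic Notation "pintro" ident(x) ident(y) := pintro1 x; pintro1 y.
Tactic Notation "pintro" ident(x) ident(y) ident(z) := pintro1 x; pintro1 y; pintro1 z.
Tactic Notation "pintro" ident(x) ident(y) ident(z) ident(t) :=
  pintro1 x; pintro1 y; pintro1 z; pintro1 t.

Ltac psplits :=
  repeat lazymatch goal with |- holds (pAnd _ _) _ => apply and_intro end.
Ltac psplit := pnorm; apply and_intro.

(** Existential elimination: [x] becomes a witness for [H] in an extension. *)
Tactic Notation "pex" hyp(H) ident(x) :=
  apply (covered_elim _ _ _ H);
  clear H; let G' := fresh "G_" in let I := fresh "I_" in
  intros G' I [x H]; cbn beta in H; transport I.

(** Disjunction elimination in [H]. *)
Tactic Notation "por" hyp(H) :=
  apply (covered_elim _ _ _ H);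
  clear H; let G' := fresh "G_" in let I := fresh "I_" in
  intros G' I H; transport I; destruct H as [H|H].

Tactic Notation "pose_ex" constr(t) "as" ident(x) ident(H) :=
  pose proof t as H; pex H x.

Ltac pexists x := apply (exists_intro _ x); cbn beta.
Ltac pleft := apply or_left.
Ltac pright := apply or_right.
Ltac pexfalso := apply bot_elim.

(** * Definable predicates *)

(** Formulas have no constants, so a parameter [x] is represented as a free
    variable. Under [k] quantifiers the free variable [x] of the whole formula has
    index [k + x]; environments [e] with [e (k + j) = j] are those that still assign
    to the free variables their own names. The list of the [k] innermost values is
    unconstrained. *)
Definition term (k : nat) (t : (nat -> nat) -> nat) : Prop :=
  exists i, forall e, (forall j, e (k + j) = j) -> t e = e i.

(** Predicates of the environment that come from a formula. The rules below follow
    the syntax of [prop], which lets definability be checked by unification. *)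
Definition definable (k : nat) (F : (nat -> nat) -> prop) : Prop :=
  exists a, forall e, (forall j, e (k + j) = j) -> F e = den a e.

Lemma term_var (k i : nat) : term k (fun e => e i).
Proof. now exists i. Qed.

Lemma term_param (k x : nat) : term k (fun _ => x).
Proof. now exists (k + x). Qed.

Lemma def_bot (k : nat) : definable k (fun _ => ⊥%P).
Proof. now exists fBot. Qed.

Lemma def_mem (k : nat) s t : term k s -> term k t -> definable k (fun e => s e ∈ t e)%P.
Proof.
  intros [i Hi] [j Hj]; exists (fMem i j); intros e E; cbn; now rewrite Hi, Hj.
Qed.

Lemma def_eq (k : nat) s t : term k s -> term k t -> definable k (fun e => s e ≐ t e)%P.
Proof.
  intros [i Hi] [j Hj]; exists (fEq i j); intros e E; cbn; now rewrite Hi, Hj.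
Qed.

Lemma def_and (k : nat) P Q :
  definable k P -> definable k Q -> definable k (fun e => P e ∧ Q e)%P.
Proof.
  intros [a Ha] [b Hb]; exists (fAnd a b); intros e E; cbn; now rewrite Ha, Hb.
Qed.

Lemma def_or (k : nat) P Q :
  definable k P -> definable k Q -> definable k (fun e => P e ∨ Q e)%P.
Proof.
  intros [a Ha] [b Hb]; exists (fOr a b); intros e E; cbn; now rewrite Ha, Hb.
Qed.

Lemma def_imp (k : nat) P Q :
  definable k P -> definable k Q -> definable k (fun e => P e ⇒ Q e)%P.
Proof.
  intros [a Ha] [b Hb]; exists (fImp a b); intros e E; cbn; now rewrite Ha, Hb.
Qed.

Lemma def_all (k : nat) (F : (nat -> nat) -> nat -> prop) :
  definable (S k) (fun e => F (fun i => e (S i)) (e 0)) ->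
  definable k (fun e => ∀ x, F e x)%P.
Proof.
  intros [a Ha]; exists (fAll a); intros e E; cbn; f_equal; extensionality x.
  now rewrite <- Ha.
Qed.

Lemma def_ex (k : nat) (F : (nat -> nat) -> nat -> prop) :
  definable (S k) (fun e => F (fun i => e (S i)) (e 0)) ->
  definable k (fun e => ∃ x, F e x)%P.
Proof.
  intros [a Ha]; exists (fEx a); intros e E; cbn; f_equal; extensionality x.
  now rewrite <- Ha.
Qed.

(** The proposition [a(x0, .., xk)], where the further free variables of [a] are
    parameters; it is what [inst a xs] denotes by [den_inst]. *)
Definition apply_form (a : form) (xs : list nat) : prop :=
  den a (fold_right scons (fun i => i) xs).

Lemma den_inst (a : form) (xs : list nat) (n : nat) (e : nat -> nat) :
  (forall j, e (n + j) = j) ->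
  den (inst a xs n) e = apply_form a (map (fun x => e (n - S x)) xs).
Proof.
  intros E; unfold inst, apply_form. rewrite den_ren; f_equal; extensionality i.
  revert i; induction xs as [|x xs IH]; intros [|i]; cbn; try reflexivity.
  - rewrite E; reflexivity.
  - rewrite E; reflexivity.
  - apply IH.
Qed.

Definition terms (k : nat) (ts : (nat -> nat) -> list nat) : Prop :=
  exists s, forall e, (forall j, e (k + j) = j) ->
    fold_right scons (fun i => i) (ts e) = (fun i => e (s i)).

Lemma terms_nil (k : nat) : terms k (fun _ => []).
Proof.
  exists (fun i => k + i); intros e E; cbn; extensionality i; now rewrite E.
Qed.

Lemma terms_cons (k : nat) t ts :
  term k t -> terms k ts -> terms k (fun e => t e :: ts e).
Proof.
  intros [i Hi] [s Hs]; exists (scons i s); intros e E; cbn.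
  rewrite Hi, Hs by trivial. extensionality j; now destruct j.
Qed.

Lemma def_apply_form (k : nat) (a : form) ts :
  terms k ts -> definable k (fun e => apply_form a (ts e)).
Proof.
  intros [s Hs]; exists (ren s a); intros e E; unfold apply_form.
  now rewrite Hs, den_ren.
Qed.

Ltac pterm := cbn beta; first [apply term_var | apply term_param].
Ltac pterms := cbn beta; first [apply terms_cons; [pterm | pterms] | apply terms_nil].

Create HintDb pdefs.
Ltac definable :=
  autounfold with pdefs; cbn beta;
  repeat (first
    [ assumption | apply def_and | apply def_or | apply def_imp | apply def_all
    | apply def_ex | apply def_mem; pterm | apply def_eq; pterm
    | apply def_bot | apply def_apply_form; pterms ]; cbn beta).

Lemma definable_form (F : nat -> prop) :
  definable 1 (fun e => F (e 0)) ->
  exists a, forall x, F x = den a (scons x (fun i => i)).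
Proof. intros [a Ha]; exists a; intros x; now rewrite <- Ha. Qed.

Lemma definable_apply_form (F : nat -> prop) :
  definable 1 (fun e => F (e 0)) -> exists a, F = fun x => apply_form a [x].
Proof. intros D; destruct (definable_form F D) as [a E]; exists a; now extensionality x. Qed.

(** Equality may be replaced in definable contexts only: propositions are arbitrary
    functions of names otherwise. *)
Lemma equal_subst (F : nat -> prop) (x y : nat) (G : list form) :
  definable 1 (fun e => F (e 0)) -> (G ⊩ x ≐ y) -> (G ⊩ F x) -> (G ⊩ F y).
Proof.
  intros D H. destruct (definable_form F D) as [a E]. rewrite !E. now apply leibniz.
Qed.

Lemma equal_sym (x y : nat) (G : list form) : (G ⊩ x ≐ y) -> (G ⊩ y ≐ x).
Proof.
  intros H. apply (equal_subst (fun z => z ≐ x)%P x y); [definable|trivial|apply equal_refl].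
Qed.

(** For [H : G ⊩ x ≐ y], [prw H K] replaces [x] by [y] in the hypothesis [K] and
    [prwg H] does so in the goal. *)
Ltac prw H K :=
  lazymatch type of H with holds (pEq ?x ?y) _ =>
    lazymatch type of K with holds ?p _ =>
      let q := eval pattern x in p in
      lazymatch q with ?F _ =>
        apply (fun D => equal_subst F x y _ D H) in K; [cbn beta in K | definable]
      end
    end
  end.

Ltac prwg H :=
  lazymatch type of H with holds (pEq ?x ?y) _ =>
    lazymatch goal with |- holds ?p _ =>
      let q := eval pattern x in p in
      lazymatch q with ?F _ =>
        apply (fun D => equal_subst F y x _ D (equal_sym _ _ _ H)); [definable | cbn beta]
      end
    end
  end.

(** * The axioms of CZF in the interpretation *)

Lemma all_congr (f g : nat -> prop) : (forall x, f x = g x) -> pAll f = pAll g.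
Proof. intros H; f_equal; now extensionality x. Qed.

Lemma ex_congr (f g : nat -> prop) : (forall x, f x = g x) -> pEx f = pEx g.
Proof. intros H; f_equal; now extensionality x. Qed.

(** Proves that a formula written with bound levels denotes a given proposition,
    by descending through the connectives to the atoms. *)
Ltac interpret :=
  cbn -[inst apply_form]; autounfold with pdefs;
  repeat lazymatch goal with
    | |- _ = pAnd _ _ => apply (f_equal2 pAnd)
    | |- _ = pOr _ _ => apply (f_equal2 pOr)
    | |- _ = pImp _ _ => apply (f_equal2 pImp)
    | |- _ = pAll _ => apply all_congr; intro
    | |- _ = pEx _ => apply ex_congr; intro
    | |- _ = apply_form _ _ => rewrite den_inst by reflexivity; reflexivity
    | |- _ => reflexivity
  end.

Lemma mem_ind (F : nat -> prop) (G : list form) :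
  definable 1 (fun e => F (e 0)) ->
  (G ⊩ ∀ x, (∀' y ∈ x, F y) ⇒ F x) -> forall x, G ⊩ F x.
Proof.
  intros D H. destruct (definable_apply_form F D) as [a ->].
  pose proof (den_valid _ (prv_ax _ [] _ (CZF_mem_ind a)) (fun i => i) G) as V.
  assert (B : den (hclose (mem_induction a)) (fun i => i) =
              ((∀ x, (∀' y ∈ x, apply_form a [y]) ⇒ apply_form a [x]) ⇒ ∀ x, apply_form a [x])%P)
    by interpret.
  rewrite B in V. exact (mp V H).
Qed.

(** Stated for a formula rather than a definable predicate, because boundedness is
    a condition on syntax. *)
Lemma separate (a : form) (e : nat -> nat) (G : list form) (x : nat) :
  Delta0 a -> G ⊩ ∃ y, ∀ z, z ∈ y ⇔ (z ∈ x ∧ den a (scons z e)).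
Proof.
  intros D.
  assert (B : den (hclose (separation a)) e =
    (∀ x, ∃ y, ∀ z, z ∈ y ⇔ (z ∈ x ∧ den a (scons z e)))%P).
  { cbn. apply all_congr; intro; apply ex_congr; intro; apply all_congr; intro.
    apply (f_equal2 pAnd); [apply (f_equal2 pImp)|apply (f_equal2 pImp)]; trivial;
    apply (f_equal2 pAnd); trivial; unfold inst; rewrite den_ren; f_equal; extensionality i;
      destruct i as [|[|i]]; reflexivity. }
  pose proof (den_valid _ (prv_ax _ [] _ (CZF_sep a D)) e G) as V.
  rewrite B in V. apply V.
Qed.

(** The counterparts, as propositions, of the formulas of the same meaning that
    state the axioms and define the Kripke model. *)
Definition Empty (x : nat) : prop := ∀ y, ¬ y ∈ x.
Definition Succ (x y : nat) : prop := ∀ z, z ∈ y ⇔ (z ∈ x ∨ z ≐ x).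
Definition UPair (a b c : nat) : prop := ∀ u, u ∈ c ⇔ (u ≐ a ∨ u ≐ b).
Definition Omega (w : nat) : prop := ∀ u, u ∈ w ⇔ (Empty u ∨ ∃' v ∈ w, Succ v u).
Definition InOmega (n : nat) : prop := ∃ w, Omega w ∧ n ∈ w.
Definition Le (p q : nat) : prop := p ∈ q ∨ p ≐ q.
Definition InUp (p q : nat) : prop := InOmega q ∧ Le p q.
Definition OPair (x y z : nat) : prop := ∀ u, u ∈ z ⇔ (UPair x x u ∨ UPair x y u).
Definition IsFun (f : nat) : prop :=
  (∀' z ∈ f, ∃ x y, OPair x y z) ∧
  (∀ x y y' z z', z ∈ f ∧ OPair x y z ∧ z' ∈ f ∧ OPair x y' z' ⇒ y ≐ y').
Definition Val (f q v : nat) : prop := ∃' z ∈ f, OPair q v z.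
Definition InDom (f q : nat) : prop := ∃ v, Val f q v.
Definition DomUp (f p : nat) : prop := ∀ q, InDom f q ⇔ InUp p q.
Definition Restr (r y y' : nat) : prop :=
  ∀ z, z ∈ y' ⇔ (z ∈ y ∧ ∃ s v, InUp r s ∧ OPair s v z).
Definition Transitive (a : nat) : prop := ∀' x ∈ a, ∀' y ∈ x, y ∈ a.
Definition Ordinal (a : nat) : prop := Transitive a ∧ ∀' x ∈ a, Transitive x.
#[global] Hint Unfold Empty Succ UPair Omega InOmega Le InUp OPair IsFun Val InDom DomUp
  Restr Transitive Ordinal : pdefs.

Lemma extensional (a b : nat) (G : list form) :
  (forall G' x, incl G G' -> (G' ⊩ x ∈ a) -> (G' ⊩ x ∈ b)) ->
  (forall G' x, incl G G' -> (G' ⊩ x ∈ b) -> (G' ⊩ x ∈ a)) ->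
  G ⊩ a ≐ b.
Proof.
  intros H1 H2.
  pose proof (den_valid _ (prv_ax _ [] _ CZF_ext) (fun i => i) G a b) as V.
  apply (mp V). intros x; split; intros G' I K; [exact (H1 _ _ I K) | exact (H2 _ _ I K)].
Qed.

Ltac pext x H :=
  apply extensional; let G' := fresh "G_" in let I := fresh "I_" in
  intros G' x I H; transport I.

Lemma upair_exists (a b : nat) (G : list form) : G ⊩ ∃ c, UPair a b c.
Proof. exact (den_valid _ (prv_ax _ [] _ CZF_pair) (fun i => i) G a b). Qed.

Lemma union_exists (a : nat) (G : list form) : G ⊩ ∃ b, ∀ x, x ∈ b ⇔ (∃' y ∈ a, x ∈ y).
Proof. exact (den_valid _ (prv_ax _ [] _ CZF_union) (fun i => i) G a). Qed.

Lemma omega_exists (G : list form) : G ⊩ ∃ w, Omega w.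
Proof. exact (den_valid _ (prv_ax _ [] _ CZF_inf) (fun i => i) G). Qed.

(** * Pairs and unions *)

Lemma mem_congr_r (x a b : nat) (G : list form) : (G ⊩ a ≐ b) -> (G ⊩ x ∈ a) -> (G ⊩ x ∈ b).
Proof. intros H K. prw H K. exact K. Qed.

Lemma mem_congr_l (x y a : nat) (G : list form) : (G ⊩ x ≐ y) -> (G ⊩ x ∈ a) -> (G ⊩ y ∈ a).
Proof. intros H K. prw H K. exact K. Qed.

Lemma equal_trans (x y z : nat) (G : list form) : (G ⊩ x ≐ y) -> (G ⊩ y ≐ z) -> (G ⊩ x ≐ z).
Proof. intros H K. prw K H. exact H. Qed.

Lemma mem_irreflexive (x : nat) (G : list form) : (G ⊩ x ∈ x) -> (G ⊩ ⊥).
Proof.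
  assert (H : G ⊩ ¬ x ∈ x); [|exact (mp H)].
  revert x; apply (mem_ind (fun x => ¬ x ∈ x)%P); [definable|].
  pintro x IH H. exact (mp (mp (IH x) H) H).
Qed.

Lemma empty_exists (G : list form) : G ⊩ ∃ o, Empty o.
Proof.
  pose_ex (separate fBot (fun i => i) G 0 D0_bot) as o Ho.
  pexists o. pintro x Hx. exact (proj2 (mp (proj1 (Ho x)) Hx)).
Qed.

Lemma empty_unique (o o' : nat) (G : list form) :
  (G ⊩ Empty o) -> (G ⊩ Empty o') -> G ⊩ o ≐ o'.
Proof. intros H H'; pext x K; pexfalso; [exact (mp (H x) K) | exact (mp (H' x) K)]. Qed.

Lemma upair_l (a b c : nat) (G : list form) : (G ⊩ UPair a b c) -> G ⊩ a ∈ c.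
Proof. intros H; apply (mp (proj2 (H a))); pleft; apply equal_refl. Qed.

Lemma upair_r (a b c : nat) (G : list form) : (G ⊩ UPair a b c) -> G ⊩ b ∈ c.
Proof. intros H; apply (mp (proj2 (H b))); pright; apply equal_refl. Qed.

Lemma upair_inv (a b c x : nat) (G : list form) :
  (G ⊩ UPair a b c) -> (G ⊩ x ∈ c) -> G ⊩ x ≐ a ∨ x ≐ b.
Proof. intros H; exact (mp (proj1 (H x))). Qed.

Lemma singleton_inv (a c x : nat) (G : list form) :
  (G ⊩ UPair a a c) -> (G ⊩ x ∈ c) -> G ⊩ x ≐ a.
Proof. intros H K; pose proof (upair_inv _ _ _ _ _ H K) as E; por E; exact E. Qed.

Lemma upair_unique (a b c c' : nat) (G : list form) :
  (G ⊩ UPair a b c) -> (G ⊩ UPair a b c') -> G ⊩ c ≐ c'.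
Proof.
  intros H H'; pext x K;
    [apply (mp (proj2 (H' x))), (mp (proj1 (H x))), K
    |apply (mp (proj2 (H x))), (mp (proj1 (H' x))), K].
Qed.

Lemma opair_exists (x y : nat) (G : list form) : G ⊩ ∃ z, OPair x y z.
Proof.
  pose_ex (upair_exists x x G) as a Ha. pose_ex (upair_exists x y G) as b Hb.
  pose_ex (upair_exists a b G) as z Hz.
  pexists z. pintro u. split.
  - pintro K. pose proof (upair_inv _ _ _ _ _ Hz K) as E; por E.
    + pleft. apply equal_sym in E. prw E Ha. exact Ha.
    + pright. apply equal_sym in E. prw E Hb. exact Hb.
  - pintro K. apply (mp (proj2 (Hz u))). por K.
    + pleft. eapply upair_unique; eassumption.
    + pright. eapply upair_unique; eassumption.
Qed.

Lemma opair_unique (x y z z' : nat) (G : list form) :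
  (G ⊩ OPair x y z) -> (G ⊩ OPair x y z') -> G ⊩ z ≐ z'.
Proof.
  intros H H'; pext u K;
    [apply (mp (proj2 (H' u))), (mp (proj1 (H u))), K
    |apply (mp (proj2 (H u))), (mp (proj1 (H' u))), K].
Qed.

(** The first component of a pair is the only object in all its members; this
    description of it is bounded, which [restr_exists] needs. *)
Lemma opair_fst_in (x y z u : nat) (G : list form) :
  (G ⊩ OPair x y z) -> (G ⊩ u ∈ z) -> G ⊩ x ∈ u.
Proof.
  intros H K. pose proof (mp (proj1 (H u)) K) as E; por E; exact (upair_l _ _ _ _ E).
Qed.

Lemma opair_fst_uniq (x y z t : nat) (G : list form) :
  (G ⊩ OPair x y z) -> (G ⊩ ∀' u ∈ z, t ∈ u) -> G ⊩ t ≐ x.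
Proof.
  intros H K. pose_ex (upair_exists x x G) as a Ha.
  apply (singleton_inv _ a); [exact Ha|].
  apply (mp (K a)), (mp (proj2 (H a))). pleft; exact Ha.
Qed.

Lemma opair_inj1 (x y x' y' z : nat) (G : list form) :
  (G ⊩ OPair x y z) -> (G ⊩ OPair x' y' z) -> G ⊩ x ≐ x'.
Proof.
  intros H H'. apply (opair_fst_uniq _ _ _ _ _ H'). pintro u K.
  exact (opair_fst_in _ _ _ _ _ H K).
Qed.

Lemma opair_inj2 (x y x' y' z : nat) (G : list form) :
  (G ⊩ OPair x y z) -> (G ⊩ OPair x' y' z) -> G ⊩ y ≐ y'.
Proof.
  intros H H'. pose proof (opair_inj1 _ _ _ _ _ _ H H') as E.
  (* [b ∈ {a, b} ∈ z], and [{a, b}] is [{c}] or [{c, d}]; used in both directions,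
     as [y ≐ x'] alone leaves [y'] open *)
  assert (snd : forall G a b c d, (G ⊩ OPair a b z) -> (G ⊩ OPair c d z) -> G ⊩ b ≐ c ∨ b ≐ d).
  { clear. intros G a b c d H H'. pose_ex (upair_exists a b G) as u Hu.
    assert (K : G ⊩ u ∈ z) by (apply (mp (proj2 (H u))); pright; exact Hu).
    apply (mp (proj1 (H' u))) in K. pose proof (upair_r _ _ _ _ Hu) as B.
    por K; [pleft; exact (singleton_inv _ _ _ _ K B) | exact (upair_inv _ _ _ _ _ K B)]. }
  pose proof (snd _ _ _ _ _ H H') as C. por C; [|exact C].
  pose proof (snd _ _ _ _ _ H' H) as D. por D.
  - apply (equal_trans _ _ _ _ C). apply (equal_trans _ x); apply equal_sym; trivial.
  - apply equal_sym, D.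
Qed.

Lemma binary_union_exists (a b : nat) (G : list form) :
  G ⊩ ∃ c, ∀ x, x ∈ c ⇔ (x ∈ a ∨ x ∈ b).
Proof.
  pose_ex (upair_exists a b G) as p Hp. pose_ex (union_exists p G) as c Hc.
  pexists c. pintro x. split.
  - pintro K. apply (mp (proj1 (Hc x))) in K. pex K y. destruct K as [Ky K].
    pose proof (upair_inv _ _ _ _ _ Hp Ky) as E. por E; [pleft | pright];
      exact (mem_congr_r _ _ _ _ E K).
  - pintro K. apply (mp (proj2 (Hc x))). por K; [pexists a|pexists b]; split; trivial.
    + exact (upair_l _ _ _ _ Hp).
    + exact (upair_r _ _ _ _ Hp).
Qed.

(** * Natural numbers *)

Lemma succ_exists (x : nat) (G : list form) : G ⊩ ∃ y, Succ x y.
Proof.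
  pose_ex (upair_exists x x G) as s Hs. pose_ex (binary_union_exists x s G) as y Hy.
  pexists y. pintro z; split; pintro K.
  - apply (mp (proj1 (Hy z))) in K. por K; [pleft; exact K | pright].
    exact (singleton_inv _ _ _ _ Hs K).
  - apply (mp (proj2 (Hy z))). por K; [pleft; exact K | pright].
    apply (mp (proj2 (Hs z))). pleft; exact K.
Qed.

Lemma succ_unique (x y y' : nat) (G : list form) :
  (G ⊩ Succ x y) -> (G ⊩ Succ x y') -> G ⊩ y ≐ y'.
Proof.
  intros H H'; pext u K;
    [apply (mp (proj2 (H' u))), (mp (proj1 (H u))), K
    |apply (mp (proj2 (H u))), (mp (proj1 (H' u))), K].
Qed.

Lemma succ_self (x y : nat) (G : list form) : (G ⊩ Succ x y) -> G ⊩ x ∈ y.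
Proof. intros H; apply (mp (proj2 (H x))); pright; apply equal_refl. Qed.

Lemma succ_mem (x y z : nat) (G : list form) : (G ⊩ Succ x y) -> (G ⊩ z ∈ x) -> G ⊩ z ∈ y.
Proof. intros H K; apply (mp (proj2 (H z))); pleft; exact K. Qed.

Lemma succ_le_self (x y : nat) (G : list form) : (G ⊩ Succ x y) -> G ⊩ Le x y.
Proof. intros H; pleft; exact (succ_self _ _ _ H). Qed.

Lemma succ_mem_le (x y z : nat) (G : list form) : (G ⊩ Succ x y) -> (G ⊩ z ∈ y) -> G ⊩ Le z x.
Proof. intros H; exact (mp (proj1 (H z))). Qed.

Lemma le_succ_mem (x y z : nat) (G : list form) : (G ⊩ Succ x y) -> (G ⊩ Le z x) -> G ⊩ z ∈ y.
Proof. intros H; exact (mp (proj2 (H z))). Qed.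

Lemma le_refl (x : nat) (G : list form) : G ⊩ Le x x.
Proof. pright; apply equal_refl. Qed.

Lemma in_omega_succ (n m : nat) (G : list form) :
  (G ⊩ InOmega n) -> (G ⊩ Succ n m) -> G ⊩ InOmega m.
Proof.
  intros H K. pex H w. destruct H as [Hw H]. pexists w; split; trivial.
  apply (mp (proj2 (Hw m))). pright. pexists n. split; trivial.
Qed.

Lemma omega_ind (F : nat -> prop) (n : nat) (G : list form) :
  definable 1 (fun e => F (e 0)) -> (G ⊩ InOmega n) ->
  (G ⊩ ∀ o, Empty o ⇒ F o) ->
  (G ⊩ ∀ n m, InOmega n ⇒ F n ⇒ Succ n m ⇒ F m) -> G ⊩ F n.
Proof.
  intros D Hn H0 HS. pex Hn w. destruct Hn as [Hw Hn].
  assert (H : G ⊩ n ∈ w ⇒ F n); [|exact (mp H Hn)]. clear Hn.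
  revert n; apply (mem_ind (fun n => n ∈ w ⇒ F n)%P); [definable|].
  pintro n IH K. apply (mp (proj1 (Hw n))) in K. por K; [exact (mp (H0 n) K)|].
  pex K m. destruct K as [Km K].
  apply (fun A => mp (mp (mp (HS m n) A) (mp (mp (IH m) (succ_self _ _ _ K)) Km)) K).
  pexists w; split; trivial.
Qed.

(** All sets that satisfy the defining condition of ω have the same elements.
    Membership in ω thereby becomes the bounded formula [n ∈ w]. *)
Lemma in_omega_fixed (n w : nat) (G : list form) :
  (G ⊩ InOmega n) -> (G ⊩ Omega w) -> G ⊩ n ∈ w.
Proof.
  intros Hn Hw. apply (omega_ind (fun n => n ∈ w)%P n); [definable|trivial| |].
  - pintro o Ho. apply (mp (proj2 (Hw o))). pleft; exact Ho.
  - pintro p q Hp IH. pintro Hq. apply (mp (proj2 (Hw q))). pright.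
    pexists p. split; trivial.
Qed.

Lemma in_omega_trans (n m : nat) (G : list form) :
  (G ⊩ InOmega n) -> (G ⊩ m ∈ n) -> G ⊩ InOmega m.
Proof.
  intros Hn K. assert (H : G ⊩ ∀' m ∈ n, InOmega m); [|exact (mp (H m) K)]. clear m K.
  apply (omega_ind (fun n => ∀' m ∈ n, InOmega m)%P n); [definable|trivial| |].
  - pintro o Ho m Km. pexfalso. exact (mp (Ho m) Km).
  - pintro k l Hk IH. pintro Hl m Km. apply (mp (proj1 (Hl m))) in Km. por Km.
    + exact (mp (IH m) Km).
    + prwg Km. exact Hk.
Qed.

Lemma omega_mem_trans (n m k : nat) (G : list form) :
  (G ⊩ InOmega n) -> (G ⊩ m ∈ n) -> (G ⊩ k ∈ m) -> G ⊩ k ∈ n.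
Proof.
  intros Hn Km Kk.
  assert (H : G ⊩ Transitive n); [|exact (mp (mp (H m) Km k) Kk)]. clear m k Km Kk.
  apply (omega_ind Transitive n); [definable|trivial| |].
  - pintro o Ho m Km. pexfalso. exact (mp (Ho m) Km).
  - pintro p q Hp IH. pintro Hq m Km. pintro k Kk. apply (succ_mem _ _ _ _ Hq).
    apply (mp (proj1 (Hq m))) in Km. por Km.
    + exact (mp (mp (IH m) Km k) Kk).
    + exact (mem_congr_r _ _ _ _ Km Kk).
Qed.

Lemma le_trans (a b c : nat) (G : list form) :
  (G ⊩ InOmega c) -> (G ⊩ Le a b) -> (G ⊩ Le b c) -> G ⊩ Le a c.
Proof.
  intros Hc H K. por K; [|prw K H; exact H].
  pleft. por H; [exact (omega_mem_trans _ _ _ _ Hc K H)|].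
  apply equal_sym in H. exact (mem_congr_l _ _ _ _ H K).
Qed.

(** Otherwise [n ∈ n], by transitivity of [n]. *)
Lemma succ_not_le (n m : nat) (G : list form) :
  (G ⊩ InOmega n) -> (G ⊩ Succ n m) -> (G ⊩ Le m n) -> G ⊩ ⊥.
Proof.
  intros Hn S L. apply (mem_irreflexive n). pose proof (succ_self _ _ _ S) as K.
  por L; [exact (omega_mem_trans _ _ _ _ Hn L K) | exact (mem_congr_r _ _ _ _ L K)].
Qed.

(** The discreteness of the order on ω; the successor is least above [r]. *)
Lemma succ_le (n r s : nat) (G : list form) :
  (G ⊩ InOmega n) -> (G ⊩ r ∈ n) -> (G ⊩ Succ r s) -> G ⊩ Le s n.
Proof.
  intros Hn K S.
  assert (H : G ⊩ r ∈ n ⇒ Le s n); [|exact (mp H K)]. clear K.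
  apply (omega_ind (fun n => r ∈ n ⇒ Le s n)%P n); [definable|trivial| |].
  - pintro o Ho K. pexfalso. exact (mp (Ho r) K).
  - pintro p q Hp IH. pintro Hq K. apply (succ_mem_le _ _ _ _ Hq) in K. por K.
    + pleft. apply (le_succ_mem _ _ _ _ Hq), (mp IH K).
    + pright. prw K S. exact (succ_unique _ _ _ _ S Hq).
Qed.

Lemma zero_le (o n : nat) (G : list form) :
  (G ⊩ Empty o) -> (G ⊩ InOmega n) -> G ⊩ Le o n.
Proof.
  intros Ho Hn. apply (omega_ind (fun n => Le o n)%P n); [definable|trivial| |].
  - pintro o' Ho'. pright. exact (empty_unique _ _ _ Ho Ho').
  - pintro p q Hp IH. pintro Hq. pleft. exact (le_succ_mem _ _ _ _ Hq IH).
Qed.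

(** A maximum would require deciding the order; adding one to a bound at each
    step of the induction does not. *)
Lemma omega_upper_bound (a b : nat) (G : list form) :
  (G ⊩ InOmega a) -> (G ⊩ InOmega b) -> G ⊩ ∃ c, InOmega c ∧ Le a c ∧ Le b c.
Proof.
  intros Ha Hb.
  apply (omega_ind (fun b => ∃ c, InOmega c ∧ Le a c ∧ Le b c)%P b); [definable|trivial| |].
  - pintro o Ho. pexists a. psplits; trivial.
    + apply le_refl.
    + exact (zero_le _ _ _ Ho Ha).
  - pintro p q Hp IH. pintro Hq. pex IH c. destruct IH as (Hc & La & Lp).
    pose_ex (succ_exists c G) as d Hd.
    pose proof (in_omega_succ _ _ _ Hc Hd) as Od.
    pexists d. psplits; trivial.
    + pleft. exact (le_succ_mem _ _ _ _ Hd La).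
    + apply (succ_le d p q); trivial. exact (le_succ_mem _ _ _ _ Hd Lp).
Qed.

Lemma up_refl (p : nat) (G : list form) : (G ⊩ InOmega p) -> G ⊩ InUp p p.
Proof. intros H; split; [trivial|apply le_refl]. Qed.

Lemma up_trans (p q r : nat) (G : list form) :
  (G ⊩ InUp p q) -> (G ⊩ InUp q r) -> G ⊩ InUp p r.
Proof.
  intros [_ H] [Hr K]; split; trivial. exact (le_trans _ _ _ _ Hr H K).
Qed.

Lemma up_succ (r s : nat) (G : list form) :
  (G ⊩ InOmega r) -> (G ⊩ Succ r s) -> G ⊩ InUp r s.
Proof.
  intros Hr S; split; [exact (in_omega_succ _ _ _ Hr S) | exact (succ_le_self _ _ _ S)].
Qed.

Lemma up_succ_cases (r s q : nat) (G : list form) :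
  (G ⊩ Succ r s) -> (G ⊩ InUp r q) -> G ⊩ q ≐ r ∨ InUp s q.
Proof.
  intros S [Hq L]. por L.
  - pright. split; trivial. exact (succ_le _ _ _ _ Hq L S).
  - pleft. exact (equal_sym _ _ _ L).
Qed.

(** * Functions and restrictions *)

Lemma fun_pair (f z : nat) (G : list form) :
  (G ⊩ IsFun f) -> (G ⊩ z ∈ f) -> G ⊩ ∃ x y, OPair x y z.
Proof. intros [H _]; exact (mp (H z)). Qed.

Lemma fun_val_unique (f q v v' : nat) (G : list form) :
  (G ⊩ IsFun f) -> (G ⊩ Val f q v) -> (G ⊩ Val f q v') -> G ⊩ v ≐ v'.
Proof.
  intros [_ H] K K'. pex K z. pex K' z'.
  apply (mp (H q v v' z z')). destruct K, K'. psplits; trivial.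
Qed.

Lemma fun_intro (f : nat) (G : list form) :
  (G ⊩ ∀' z ∈ f, ∃ x y, OPair x y z) ->
  (G ⊩ ∀ q v v', Val f q v ⇒ Val f q v' ⇒ v ≐ v') -> G ⊩ IsFun f.
Proof.
  intros H K; split; trivial. pintro q v v' z. pintro z' M.
  destruct M as (M1 & M2 & M3 & M4).
  apply (fun A B => mp (mp (K q v v') A) B); [pexists z|pexists z']; split; trivial.
Qed.

Lemma val_subset (f g q v : nat) (G : list form) :
  (G ⊩ ∀' z ∈ g, z ∈ f) -> (G ⊩ Val g q v) -> G ⊩ Val f q v.
Proof.
  intros H K. pex K z. destruct K as [K1 K2]. pexists z. split; trivial. exact (mp (H z) K1).
Qed.

Lemma fun_subset (f g : nat) (G : list form) :
  (G ⊩ IsFun f) -> (G ⊩ ∀' z ∈ g, z ∈ f) -> G ⊩ IsFun g.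
Proof.
  intros Hf H. apply fun_intro.
  - pintro z K. exact (fun_pair _ _ _ Hf (mp (H z) K)).
  - pintro q v v' K. pintro K'.
    apply (fun_val_unique f q); trivial; eapply val_subset; eassumption.
Qed.

Lemma val_of_mem (f z q v : nat) (G : list form) :
  (G ⊩ Val f q v) -> (G ⊩ OPair q v z) -> G ⊩ z ∈ f.
Proof.
  intros H K. pex H z'. destruct H as [H H'].
  exact (mem_congr_l _ _ _ _ (opair_unique _ _ _ _ _ H' K) H).
Qed.

(** Functions are compared through their values from here on, without their pairs. *)
Lemma fun_ext (f g : nat) (G : list form) :
  (G ⊩ IsFun f) -> (G ⊩ IsFun g) -> (G ⊩ ∀ q v, Val f q v ⇔ Val g q v) -> G ⊩ f ≐ g.
Proof.
  intros Hf Hg H; pext z K.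
  - pose proof (fun_pair _ _ _ Hf K) as P. pex P q. pex P v.
    apply (val_of_mem g z q v); trivial. apply (mp (proj1 (H q v))). pexists z; split; trivial.
  - pose proof (fun_pair _ _ _ Hg K) as P. pex P q. pex P v.
    apply (val_of_mem f z q v); trivial. apply (mp (proj2 (H q v))). pexists z; split; trivial.
Qed.

Lemma dom_up_val (x p q v : nat) (G : list form) :
  (G ⊩ DomUp x p) -> (G ⊩ Val x q v) -> G ⊩ InUp p q.
Proof. intros H K. apply (mp (proj1 (H q))). pexists v. exact K. Qed.

Lemma restr_subset (r y y' : nat) (G : list form) :
  (G ⊩ Restr r y y') -> G ⊩ ∀' z ∈ y', z ∈ y.
Proof. intros H. pintro z K. exact (proj1 (mp (proj1 (H z)) K)). Qed.

Lemma restr_val (r y y' q v : nat) (G : list form) :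
  (G ⊩ Restr r y y') -> (G ⊩ Val y' q v ⇔ (Val y q v ∧ InUp r q)).
Proof.
  intros H; psplit; pintro K.
  - split; [exact (val_subset _ _ _ _ _ (restr_subset _ _ _ _ H) K)|].
    pex K z. destruct K as [K P]. apply (mp (proj1 (H z))) in K.
    destruct K as [_ K]. pex K s. pex K v'. destruct K as [U P'].
    pose proof (opair_inj1 _ _ _ _ _ _ P' P) as E. prw E U. exact U.
  - destruct K as [K U]. pex K z. destruct K as [K P]. pexists z. split; trivial.
    apply (mp (proj2 (H z))). split; trivial. pexists q. pexists v. split; trivial.
Qed.

Lemma restr_intro (r y y' : nat) (G : list form) :
  (G ⊩ IsFun y) -> (G ⊩ IsFun y') ->
  (G ⊩ ∀ q v, Val y' q v ⇔ (Val y q v ∧ InUp r q)) -> G ⊩ Restr r y y'.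
Proof.
  intros Hy Hy' H. pintro z; split; pintro K.
  - pose proof (fun_pair _ _ _ Hy' K) as P. pex P q. pex P v.
    assert (V : G ⊩ Val y' q v) by (pexists z; split; trivial).
    apply (mp (proj1 (H q v))) in V. destruct V as [V U].
    split; [exact (val_of_mem _ _ _ _ _ V P)|]. pexists q. pexists v. split; trivial.
  - destruct K as [K L]. pex L q. pex L v. destruct L as [U P].
    apply (val_of_mem y' z q v); trivial. apply (mp (proj2 (H q v))). split; trivial.
    pexists z. split; trivial.
Qed.

Lemma restr_fun (r y y' : nat) (G : list form) :
  (G ⊩ IsFun y) -> (G ⊩ Restr r y y') -> G ⊩ IsFun y'.
Proof. intros H R; exact (fun_subset _ _ _ H (restr_subset _ _ _ _ R)). Qed.

(** The elements kept by a restriction are pairs whose first component is in ↑r,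
    which is not a bounded condition as it stands. For a member of a function it is
    equivalent to one that finds the first component among the elements of the
    elements of the pair. *)
Lemma restr_exists (r y : nat) (G : list form) :
  (G ⊩ IsFun y) -> G ⊩ ∃ y', Restr r y y'.
Proof.
  intros Hy. pose_ex (omega_exists G) as w Hw.
  (* with [z] as variable 0 and the parameters [r], [w] as 1, 2 outside the binders:
     [∃ u ∈ z, ∃ s ∈ u, (∀ t ∈ z, s ∈ t) ∧ s ∈ w ∧ (r ∈ s ∨ r = s)] *)
  set (a := fEx (fAnd (fMem 0 1) (fEx (fAnd (fMem 0 1)
         (fAnd (fAll (fImp (fMem 0 3) (fMem 1 0)))
         (fAnd (fMem 0 4) (fOr (fMem 3 0) (fEq 3 0)))))))).
  assert (D : Delta0 a) by (unfold a; repeat constructor).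
  pose_ex (separate a (scons r (scons w (fun i => i))) G y D) as y' S.
  change (G ⊩ ∀ z, z ∈ y' ⇔ (z ∈ y ∧ ∃' u ∈ z, ∃' s ∈ u, (∀' t ∈ z, s ∈ t) ∧ s ∈ w ∧ Le r s)) in S.
  pexists y'. pintro z; split; pintro K.
  - apply (mp (proj1 (S z))) in K. destruct K as [Ky K]. split; trivial.
    pose proof (fun_pair _ _ _ Hy Ky) as P. pex P q. pex P v.
    pexists q. pexists v. split; trivial.
    pex K u. destruct K as [_ K]. pex K s. destruct K as (_ & K & Ks & L).
    pose proof (opair_fst_uniq _ _ _ _ _ P K) as E.
    prw E Ks. prw E L. split; trivial. pexists w. split; trivial.
  - destruct K as [Ky K]. apply (mp (proj2 (S z))). split; trivial.
    pex K q. pex K v. destruct K as [[Oq L] P].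
    pose_ex (upair_exists q q G) as u Hu.
    pexists u. split; [apply (mp (proj2 (P u))); pleft; exact Hu|].
    pexists q. split; [exact (upair_l _ _ _ _ Hu)|]. split; [|split; trivial].
    + pintro t Kt. exact (opair_fst_in _ _ _ _ _ P Kt).
    + exact (in_omega_fixed _ _ _ Oq Hw).
Qed.

Lemma restr_self (r x x' : nat) (G : list form) :
  (G ⊩ IsFun x) -> (G ⊩ DomUp x r) -> (G ⊩ Restr r x x') -> G ⊩ x' ≐ x.
Proof.
  intros Hx D R. apply fun_ext; [exact (restr_fun _ _ _ _ Hx R)|trivial|].
  pintro q v; split; pintro K.
  - exact (proj1 (mp (proj1 (restr_val _ _ _ q v _ R)) K)).
  - apply (mp (proj2 (restr_val _ _ _ q v _ R))). split; trivial.
    exact (dom_up_val _ _ _ _ _ D K).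
Qed.

(** Restricting further is the same from a restriction as from the whole. *)
Lemma restr_restr (p q x xp xq : nat) (G : list form) :
  (G ⊩ InUp p q) -> (G ⊩ Restr p x xp) -> (G ⊩ Restr q x xq) -> G ⊩ Restr q xp xq.
Proof.
  intros U Rp Rq. pintro z; split; pintro K.
  - apply (mp (proj1 (Rq z))) in K. destruct K as [K L]. split; trivial.
    apply (mp (proj2 (Rp z))). split; trivial.
    pex L s. pex L v. destruct L as [Us P]. pexists s. pexists v. split; trivial.
    exact (up_trans _ _ _ _ U Us).
  - destruct K as [K L]. apply (mp (proj2 (Rq z))). split; trivial.
    exact (proj1 (mp (proj1 (Rp z)) K)).
Qed.

(** * Kripke sets and the classes K^m *)

Definition VStep (nu : form) (alpha p x : nat) : prop :=
  IsFun x ∧ DomUp x p ∧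
  (∀ q xq, InUp p q ∧ Val x q xq ⇒ ∀' y ∈ xq, ∃' beta ∈ alpha, apply_form nu [beta; q; y]) ∧
  (∀ q r xq xr, InUp p q ∧ InUp q r ∧ Val x q xq ∧ Val x r xr ⇒
     ∀' y ∈ xq, ∀ y', Restr r y y' ⇒ y' ∈ xr).

Definition InV (nu : form) (x : nat) : prop :=
  ∃ p alpha, InOmega p ∧ Ordinal alpha ∧ apply_form nu [alpha; p; x].

Definition KStep (nu : form) (m x a : nat) : prop :=
  InV nu x ∧
  (∀ p xp, Val x p xp ⇒ ∀' y ∈ xp, y ∈ a) ∧
  (∀ p q xp xq, Val x p xp ∧ Val x q xq ∧ Le m p ∧ Le p q ⇒
     ∀ y, y ∈ xq ⇔ (∃' u ∈ xp, Restr q u y)).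

Definition InK (kappa : form) (p x : nat) : prop :=
  ∃ m, InOmega m ∧ apply_form kappa [m; x] ∧ DomUp x p.
#[global] Hint Unfold VStep InV KStep InK : pdefs.

Lemma V_iff (nu : form) (alpha p x : nat) (G : list form) :
  defines_V nu -> (G ⊩ Ordinal alpha) -> (G ⊩ InOmega p) ->
  G ⊩ apply_form nu [alpha; p; x] ⇔ VStep nu alpha p x.
Proof.
  intros hV Ha Hp.
  pose proof (den_valid _ hV (fun i => i) G) as V.
  assert (B : den (hclose (∀ alpha p x, is_ordinal alpha ∧ in_omega p ⇒
                (inst nu [alpha; p; x] ⇔ V_step nu alpha p x))%H) (fun i => i) =
     (∀ alpha p x, Ordinal alpha ∧ InOmega p ⇒
                (apply_form nu [alpha; p; x] ⇔ VStep nu alpha p x))%P) by interpret.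
  rewrite B in V. apply (mp (V alpha p x)). split; trivial.
Qed.

Lemma K_intro (nu kappa : form) (m x a : nat) (G : list form) :
  defines_K nu kappa -> (G ⊩ InOmega m) -> (G ⊩ ∀' y ∈ a, apply_form kappa [m; y]) ->
  (G ⊩ KStep nu m x a) -> G ⊩ apply_form kappa [m; x].
Proof.
  intros [hK _] Hm Ha Hx.
  pose proof (den_valid _ hK (fun i => i) G) as V.
  assert (B : den (hclose (∀ m, in_omega m ⇒ K_closed nu kappa m)%H) (fun i => i) =
     (∀ m, InOmega m ⇒ ∀ x a, (∀' y ∈ a, apply_form kappa [m; y]) ∧ KStep nu m x a ⇒
        apply_form kappa [m; x])%P) by interpret.
  rewrite B in V. apply (mp (mp (V m) Hm x a)). split; trivial.
Qed.

(** The schema of leastness speaks of classes [{x | phi(m, x)}]; a definable [F]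
    gives such a class that does not depend on [m]. *)
Lemma K_least (nu kappa : form) (F : nat -> prop) (m x : nat) (G : list form) :
  defines_K nu kappa -> definable 1 (fun e => F (e 0)) -> (G ⊩ InOmega m) ->
  (G ⊩ ∀ x a, (∀' y ∈ a, F y) ∧ KStep nu m x a ⇒ F x) ->
  (G ⊩ apply_form kappa [m; x]) -> G ⊩ F x.
Proof.
  intros [_ hK] D Hm HF Hx. destruct (definable_apply_form F D) as [b ->].
  (* [ren S b] skips the variable 0, which stands for [m] *)
  pose proof (den_valid _ (hK (ren S b)) (fun i => i) G) as V.
  assert (B : den (hclose (∀ m, in_omega m ⇒ K_closed nu (ren S b) m ⇒
                  ∀ x, inst kappa [m; x] ⇒ inst (ren S b) [m; x])%H) (fun i => i) =
     (∀ m, InOmega m ⇒ (∀ x a, (∀' y ∈ a, apply_form (ren S b) [m; y]) ∧ KStep nu m x a ⇒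
        apply_form (ren S b) [m; x]) ⇒ ∀ x, apply_form kappa [m; x] ⇒ apply_form (ren S b) [m; x])%P)
    by interpret.
  rewrite B in V. clear B.
  assert (E : forall y, apply_form (ren S b) [m; y] = apply_form b [y]).
  { intros y. unfold apply_form. now rewrite den_ren. }
  rewrite <- E.
  refine (mp (mp (mp (V m) Hm) _ x) Hx).
  pintro z a H. rewrite E. apply (mp (HF z a)).
  destruct H as [H H']; split; trivial.
  pintro y K. rewrite <- E. exact (mp (H y) K).
Qed.

(** The least class is a fixed point of its generating step: the class of all [x]
    generated from a subset of [K^m] is closed, since [K^m] contains it. *)
Lemma K_inv (nu kappa : form) (m x : nat) (G : list form) :
  defines_K nu kappa -> (G ⊩ InOmega m) -> (G ⊩ apply_form kappa [m; x]) ->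
  G ⊩ ∃ a, (∀' y ∈ a, apply_form kappa [m; y]) ∧ KStep nu m x a.
Proof.
  intros hK Hm.
  apply (K_least nu kappa
    (fun x => ∃ a, (∀' y ∈ a, apply_form kappa [m; y]) ∧ KStep nu m x a)%P); trivial; [definable|].
  pintro z a H. destruct H as [H Hz]. pexists a. split; trivial.
  pintro y K. pose proof (mp (H y) K) as Hy. pex Hy b. destruct Hy as [Hb Hy].
  exact (K_intro _ _ _ _ _ _ hK Hm Hb Hy).
Qed.

Lemma K_V (nu kappa : form) (m x : nat) (G : list form) :
  defines_K nu kappa -> (G ⊩ InOmega m) -> (G ⊩ apply_form kappa [m; x]) -> G ⊩ InV nu x.
Proof.
  intros hK Hm H. apply (K_inv _ _ _ _ _ hK Hm) in H. pex H a. apply H.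
Qed.

Lemma V_inv (nu : form) (x : nat) (G : list form) :
  defines_V nu -> (G ⊩ InV nu x) ->
  G ⊩ ∃ p alpha, InOmega p ∧ Ordinal alpha ∧ VStep nu alpha p x.
Proof.
  intros hV H. pex H p. pex H alpha. destruct H as (Hp & Ha & H).
  pexists p. pexists alpha. psplits; trivial.
  exact (mp (proj1 (V_iff nu alpha p x G hV Ha Hp)) H).
Qed.

Lemma V_fun (nu : form) (x : nat) (G : list form) :
  defines_V nu -> (G ⊩ InV nu x) -> G ⊩ IsFun x.
Proof.
  intros hV H. apply (V_inv _ _ _ hV) in H. pex H p. pex H alpha. apply H.
Qed.

Lemma V_val_omega (nu : form) (x q v : nat) (G : list form) :
  defines_V nu -> (G ⊩ InV nu x) -> (G ⊩ Val x q v) -> G ⊩ InOmega q.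
Proof.
  intros hV H K. apply (V_inv _ _ _ hV) in H. pex H p. pex H alpha.
  destruct H as (_ & _ & _ & D & _). exact (proj1 (dom_up_val _ _ _ _ _ D K)).
Qed.

(** Being constant from [m] on is a stronger condition than from a later [m'] on.
    The stages [p] above [m'] have to be natural numbers for [m ≤ m' ≤ p] to give
    [m ≤ p], which they are as elements of the domain of a Kripke set. *)
Lemma K_mono (nu kappa : form) (m m' x : nat) (G : list form) :
  defines_V nu -> defines_K nu kappa ->
  (G ⊩ InOmega m) -> (G ⊩ InOmega m') -> (G ⊩ Le m m') ->
  (G ⊩ apply_form kappa [m; x]) -> G ⊩ apply_form kappa [m'; x].
Proof.
  intros hV hK Hm Hm' L.
  apply (K_least nu kappa (fun x => apply_form kappa [m'; x])); trivial; [definable|].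
  pintro y a H. destruct H as [Ha (H1 & H2 & H3)].
  apply (K_intro nu kappa m' y a G); trivial. split; [|split]; trivial.
  pintro p q xp xq. pintro H. destruct H as (Vp & Vq & Lp & Lq).
  apply (mp (H3 p q xp xq)). psplits; trivial.
  exact (le_trans _ _ _ _ (V_val_omega _ _ _ _ _ hV H1 Vp) L Lp).
Qed.

(** * Forcing of membership *)

(** What forcing at [p] of the membership of [x] in [y] unfolds to. *)
Definition FMem (p x y : nat) : prop :=
  ∃ x' y', Restr p x x' ∧ Restr p y y' ∧ ∃ yp, Val y' p yp ∧ x' ∈ yp.
#[global] Hint Unfold FMem : pdefs.

Lemma forced_mem_intro (nu : form) (p x x' y v : nat) (G : list form) :
  defines_V nu -> (G ⊩ InV nu y) -> (G ⊩ Restr p x x') -> (G ⊩ Val y p v) -> (G ⊩ x' ∈ v) ->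
  G ⊩ FMem p x y.
Proof.
  intros hV Hy Hx Hv K.
  pose_ex (restr_exists p y G (V_fun _ _ _ hV Hy)) as y' R.
  pexists x'. pexists y'. psplits; trivial. pexists v. split; trivial.
  apply (mp (proj2 (restr_val _ _ _ p v _ R))). split; trivial.
  apply up_refl, (V_val_omega nu y p v); trivial.
Qed.

Lemma forced_mem_elim (p x y : nat) (G : list form) :
  (G ⊩ FMem p x y) -> G ⊩ ∃ x' v, Restr p x x' ∧ Val y p v ∧ x' ∈ v.
Proof.
  intros H. pex H x'. pex H y'. destruct H as (Rx & Ry & H). pex H v. destruct H as [Hv K].
  pexists x'. pexists v. psplits; trivial.
  exact (proj1 (mp (proj1 (restr_val _ _ _ p v _ Ry)) Hv)).
Qed.

(** Once an element, always an element: the value of a Kripke set at a later stage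
    contains the restrictions of the elements at the earlier one. *)
Lemma forced_mem_mono (nu : form) (p q x xq y : nat) (G : list form) :
  defines_V nu -> (G ⊩ InV nu y) -> (G ⊩ FMem p x y) -> (G ⊩ InUp p q) ->
  (G ⊩ Restr q x xq) -> G ⊩ ∃ v, Val y q v ∧ xq ∈ v.
Proof.
  intros hV Hy H U Rq. apply forced_mem_elim in H. pex H xp. pex H vp.
  destruct H as (Rp & Hv & K).
  apply (V_inv _ _ _ hV) in Hy. pex Hy r. pex Hy alpha.
  destruct Hy as (Hr & _ & _ & D & _ & M).
  pose proof (dom_up_val _ _ _ _ _ D Hv) as Up.
  pose proof (mp (proj2 (D q)) (up_trans _ _ _ _ Up U)) as Vq. pex Vq vq.
  pexists vq. split; trivial.
  apply (fun A => mp (mp (mp (M p q vp vq) A xp) K xq) (restr_restr _ _ _ _ _ _ U Rp Rq)).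
  psplits; trivial.
Qed.

(** * Delaying a Kripke set *)

(** With [s = r + 1], [z'] is the function on ↑r that is empty at [r] and agrees
    with [z] from the next stage on. *)
Definition Delayed (z r s z' : nat) : prop :=
  IsFun z' ∧ ∀ q v, Val z' q v ⇔ ((q ≐ r ∧ Empty v) ∨ (InUp s q ∧ Val z q v)).

Lemma delayed_exists (z r s : nat) (G : list form) :
  (G ⊩ IsFun z) -> (G ⊩ InOmega r) -> (G ⊩ Succ r s) -> G ⊩ ∃ z', Delayed z r s z'.
Proof.
  intros Hz Hr S.
  (* [z' = z|↑s ∪ {(r, ∅)}] *)
  pose_ex (restr_exists s z G Hz) as t R. pose_ex (empty_exists G) as o Ho.
  pose_ex (opair_exists r o G) as c C. pose_ex (upair_exists c c G) as d D.
  pose_ex (binary_union_exists t d G) as z' U.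
  pose proof (restr_fun _ _ _ _ Hz R) as Ht.
  assert (V : G ⊩ ∀ q v, Val z' q v ⇔ ((q ≐ r ∧ Empty v) ∨ (InUp s q ∧ Val z q v))).
  { pintro q v. split; pintro K.
    - pex K y. destruct K as [K P]. apply (mp (proj1 (U y))) in K. por K; [pright|pleft].
      + assert (Vt : G ⊩ Val t q v) by (pexists y; split; trivial).
        apply (mp (proj1 (restr_val _ _ _ q v _ R))) in Vt. destruct Vt; split; trivial.
      + pose proof (singleton_inv _ _ _ _ D K) as E. prw E P. split.
        * exact (opair_inj1 _ _ _ _ _ _ P C).
        * pose proof (opair_inj2 _ _ _ _ _ _ P C) as E'. prwg E'. exact Ho.
    - por K; destruct K as [K L].
      + pexists c. split.
        * apply (mp (proj2 (U c))). pright. exact (upair_l _ _ _ _ D).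
        * apply equal_sym in K. prw K C. pose proof (empty_unique _ _ _ Ho L) as E.
          prw E C. exact C.
      + assert (Vt : G ⊩ Val t q v)
          by (apply (mp (proj2 (restr_val _ _ _ q v _ R))); split; trivial).
        pex Vt y. destruct Vt as [Ky P]. pexists y. split; trivial.
        apply (mp (proj2 (U y))). pleft. exact Ky. }
  pexists z'. split; [|exact V]. apply fun_intro.
  - pintro y K. apply (mp (proj1 (U y))) in K. por K; [exact (fun_pair _ _ _ Ht K)|].
    pose proof (singleton_inv _ _ _ _ D K) as E. pexists r. pexists o.
    prwg E. exact C.
  - pintro q v v' K. pintro K'.
    apply (mp (proj1 (V q v))) in K. apply (mp (proj1 (V q v'))) in K'.
    por K; por K'; destruct K as [K1 K2], K' as [L1 L2].
    + exact (empty_unique _ _ _ K2 L2).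
    (* [s] is not at most [r], so [z|↑s] has no value at [r] *)
    + pexfalso. prw K1 L1. exact (succ_not_le _ _ _ Hr S (proj2 L1)).
    + pexfalso. prw L1 K1. exact (succ_not_le _ _ _ Hr S (proj2 K1)).
    + exact (fun_val_unique _ _ _ _ _ Hz K2 L2).
Qed.

(** From stage [s] on the delay is over, so [z'] and [z] have the same
    restrictions. *)
Lemma delayed_restr (z r s z' t zt : nat) (G : list form) :
  (G ⊩ IsFun z) -> (G ⊩ InOmega r) -> (G ⊩ Succ r s) -> (G ⊩ Delayed z r s z') ->
  (G ⊩ InUp s t) -> (G ⊩ Restr t z zt) -> G ⊩ Restr t z' zt.
Proof.
  intros Hz Hr S [Hz' D] U R. apply restr_intro; [trivial|exact (restr_fun _ _ _ _ Hz R)|].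
  pintro q v; split; pintro K.
  - apply (mp (proj1 (restr_val _ _ _ q v _ R))) in K. destruct K as [K L].
    split; trivial. apply (mp (proj2 (D q v))). pright. split; trivial.
    exact (up_trans _ _ _ _ U L).
  - destruct K as [K L]. apply (mp (proj2 (restr_val _ _ _ q v _ R))). split; trivial.
    apply (mp (proj1 (D q v))) in K. por K; destruct K as [K K']; trivial.
    pexfalso. prw K L. exact (succ_not_le _ _ _ Hr S (proj2 (up_trans _ _ _ _ U L))).
Qed.

Lemma delayed_dom (z r s z' : nat) (G : list form) :
  (G ⊩ ∀ q, InUp r q ⇒ InDom z q) -> (G ⊩ InOmega r) -> (G ⊩ Succ r s) ->
  (G ⊩ Delayed z r s z') -> G ⊩ DomUp z' r.
Proof.
  intros Dz Hr S [_ D]. pintro q; split; pintro K.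
  - pex K v. apply (mp (proj1 (D q v))) in K. por K; destruct K as [K K'].
    + prwg K. apply up_refl, Hr.
    + exact (up_trans _ _ _ _ (up_succ _ _ _ Hr S) K).
  - pose proof (mp (Dz q) K) as Vz. pose proof (up_succ_cases _ _ _ _ S K) as C. por C.
    + pose_ex (empty_exists G) as o Ho. pexists o. apply (mp (proj2 (D q o))).
      pleft. split; trivial.
    + pex Vz v. pexists v. apply (mp (proj2 (D q v))). pright. split; trivial.
Qed.

(** The values of [z'] are empty or values of [z], so their elements have the same
    ranks. Starting with the empty value keeps the values growing. *)
Lemma delayed_V (nu : form) (z r s z' : nat) (G : list form) :
  defines_V nu -> (G ⊩ InV nu z) -> (G ⊩ InDom z r) -> (G ⊩ Succ r s) ->
  (G ⊩ Delayed z r s z') -> G ⊩ InV nu z'.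
Proof.
  intros hV Hz Vr S D. apply (V_inv _ _ _ hV) in Hz. pex Hz p. pex Hz alpha.
  destruct Hz as (Hp & Ha & Fz & Dz & Mz & Rz).
  pose proof (mp (proj1 (Dz r)) Vr) as Up. pose proof (proj1 Up) as Hr.
  pexists r. pexists alpha. psplits; trivial.
  apply (mp (proj2 (V_iff nu alpha r z' G hV Ha Hr))).
  assert (Dz' : G ⊩ DomUp z' r).
  { apply (delayed_dom z r s); trivial. pintro q U.
    apply (mp (proj2 (Dz q))). exact (up_trans _ _ _ _ Up U). }
  destruct D as [Fz' D].
  assert (A : G ⊩ InUp p s) by (exact (up_trans _ _ _ _ Up (up_succ _ _ _ Hr S))).
  split; [|split; [|split]]; trivial.
  - pintro q v H. destruct H as [U V]. pintro y K.
    apply (mp (proj1 (D q v))) in V. por V; destruct V as [V V'].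
    + pexfalso. exact (mp (V' y) K).
    + apply (fun B => mp (mp (Mz q v) B y) K). split; trivial.
      exact (up_trans _ _ _ _ A V).
  - pintro q t vq vt. pintro H. destruct H as (Uq & Ut & Vq & Vt).
    pintro y K y'. pintro R.
    apply (mp (proj1 (D q vq))) in Vq. por Vq; destruct Vq as [Vq Vq'].
    + pexfalso. exact (mp (Vq' y) K).
    + apply (mp (proj1 (D t vt))) in Vt. por Vt; destruct Vt as [Vt Vt'].
      * pexfalso. prw Vt Ut.
        exact (succ_not_le _ _ _ Hr S (proj2 (up_trans _ _ _ _ Vq Ut))).
      * refine (mp (mp (mp (Rz q t vq vt) _ y) K y') R). psplits; trivial.
        exact (up_trans _ _ _ _ A Vq).
Qed.

(** The only new change of value is from [r] to [s], which is before [s]. *)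
Lemma delayed_K (nu kappa : form) (m z r s z' : nat) (G : list form) :
  defines_V nu -> defines_K nu kappa -> (G ⊩ InOmega m) -> (G ⊩ apply_form kappa [m; z]) ->
  (G ⊩ Le m r) -> (G ⊩ InOmega r) -> (G ⊩ InDom z r) -> (G ⊩ Succ r s) ->
  (G ⊩ Delayed z r s z') -> G ⊩ apply_form kappa [s; z'].
Proof.
  intros hV hK Hm Kz L Hr Vr S D.
  apply (K_inv _ _ _ _ _ hK Hm) in Kz. pex Kz a. destruct Kz as (Ha & Vz & Mz & Cz).
  pose proof (in_omega_succ _ _ _ Hr S) as Hs.
  pose proof (le_trans _ _ _ _ Hs L (succ_le_self _ _ _ S)) as Ls.
  pose proof (delayed_V _ _ _ _ _ _ hV Vz Vr S D) as Vz'. destruct D as [_ D].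
  apply (K_intro nu kappa s z' a); trivial.
  - pintro y K. apply (K_mono nu kappa m s); trivial. exact (mp (Ha y) K).
  - split; [|split]; trivial.
    + pintro q v V. pintro y K. apply (mp (proj1 (D q v))) in V. por V; destruct V as [V V'].
      * pexfalso. exact (mp (V' y) K).
      * exact (mp (mp (Mz q v) V' y) K).
    + pintro p q vp vq. pintro H. destruct H as (Vp & Vq & Lp & Lq).
      apply (mp (proj1 (D p vp))) in Vp. apply (mp (proj1 (D q vq))) in Vq.
      por Vp; destruct Vp as [Up Vp].
      * pexfalso. prw Up Lp. exact (succ_not_le _ _ _ Hr S Lp).
      * por Vq; destruct Vq as [Uq Vq].
        -- pexfalso. prw Uq Lq. exact (succ_not_le _ _ _ Hr S (le_trans _ _ _ _ Hr Lp Lq)).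
        -- apply (mp (Cz p q vp vq)). psplits; trivial.
           exact (le_trans _ _ _ _ (proj1 Up) Ls Lp).
Qed.

(** A member of [K^m] with [m ≤ r] has at [s] only restrictions of elements it
    has at [r], and [z'] has none there. *)
Lemma delayed_not_K (nu kappa : form) (m z r s z' v w : nat) (G : list form) :
  defines_K nu kappa -> (G ⊩ InOmega m) -> (G ⊩ InOmega r) -> (G ⊩ Le m r) ->
  (G ⊩ Succ r s) -> (G ⊩ Delayed z r s z') -> (G ⊩ Val z s v) -> (G ⊩ w ∈ v) ->
  (G ⊩ apply_form kappa [m; z']) -> G ⊩ ⊥.
Proof.
  intros hK Hm Hr L S [_ D] V K Kz'.
  apply (K_inv _ _ _ _ _ hK Hm) in Kz'. pex Kz' a. destruct Kz' as (_ & _ & _ & C).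
  pose_ex (empty_exists G) as o Ho.
  assert (V' : G ⊩ Val z' s v).
  { apply (mp (proj2 (D s v))). pright. split; trivial.
    apply up_refl. exact (in_omega_succ _ _ _ Hr S). }
  assert (Vo : G ⊩ Val z' r o)
    by (apply (mp (proj2 (D r o))); pleft; split; trivial; apply equal_refl).
  assert (E : G ⊩ ∃' u ∈ o, Restr s u w).
  { refine (mp (proj1 (mp (C r s o v) _ w)) K). psplits; trivial.
    exact (succ_le_self _ _ _ S). }
  pex E u. exact (mp (Ho u) (proj1 E)).
Qed.

(** At the successor of any node above [r] the delay is over, and [z'] restricts
    to the same set as [z], which [x] contains. So nothing refutes the membership
    of [z'] in [x]. *)
Lemma delayed_dense (nu : form) (x z z' p r s : nat) (G : list form) :
  defines_V nu -> (G ⊩ InV nu x) -> (G ⊩ InV nu z) -> (G ⊩ FMem p z x) ->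
  (G ⊩ InUp p r) -> (G ⊩ Succ r s) -> (G ⊩ Delayed z r s z') ->
  G ⊩ ∀ a, InUp r a ⇒ (∀ b, InUp a b ⇒ FMem b z' x ⇒ ⊥) ⇒ ⊥.
Proof.
  intros hV Vx Vz Fzx Upr S D. pose proof (proj1 Upr) as Hr.
  pintro a Ura N. pose_ex (succ_exists a G) as b Sb.
  pose proof (up_succ _ _ _ (proj1 Ura) Sb) as Uab.
  assert (Usb : G ⊩ InUp s b).
  { split; [exact (proj1 Uab)|]. apply (succ_le b r); trivial; [exact (proj1 Uab)|].
    exact (le_succ_mem _ _ _ _ Sb (proj2 Ura)). }
  pose proof (V_fun _ _ _ hV Vz) as Fz.
  pose_ex (restr_exists b z G Fz) as zb R.
  apply (mp (mp (N b) Uab)).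
  pose proof (up_trans _ _ _ _ (up_trans _ _ _ _ Upr Ura) Uab) as Upb.
  pose_ex (forced_mem_mono _ _ _ _ _ _ _ hV Vx Fzx Upb R) as v Hv.
  destruct Hv as [Hv K].
  apply (forced_mem_intro nu b z' zb x v); trivial.
  exact (delayed_restr _ _ _ _ _ _ _ Fz Hr S D Usb R).
Qed.

(** * The axiom of anti-double complement in K *)

(** The forcing clauses of the axiom, at the node [o] and written out; the nodes are
    quantified once for every implication and universal quantifier. *)
Definition ForcedADCom (kappa : form) (o : nat) : prop :=
  ∀ q, InUp o q ⇒ ∀ x, InK kappa q x ⇒ ∀ q1, InUp q q1 ⇒
  (∃ y, InK kappa q1 y ∧
     ∀ q2, InUp q1 q2 ⇒ ∀ z, InK kappa q2 z ⇒ ∀ q3, InUp q2 q3 ⇒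
     (∀ a, InUp q3 a ⇒ (∀ b, InUp a b ⇒ FMem b z x ⇒ ⊥) ⇒ ⊥) ⇒ FMem q3 z y) ⇒
  ∀ q2, InUp q1 q2 ⇒ ∀ z, InK kappa q2 z ⇒ ∀ q3, InUp q2 q3 ⇒ FMem q3 z x ⇒
  ∀ q4, InUp q3 q4 ⇒ ∀ w, InK kappa q4 w ⇒ ∀ q5, InUp q4 q5 ⇒ FMem q5 w z ⇒ ⊥.
#[global] Hint Unfold ForcedADCom : pdefs.

Lemma K_validates_den (kappa : form) :
  den (hclose (K_validates kappa ADCom)) (fun i => i) =
  (∀ o, Empty o ⇒ ForcedADCom kappa o)%P.
Proof. interpret. Qed.

Lemma forced_ADCom (nu kappa : form) (o : nat) (G : list form) :
  defines_V nu -> defines_K nu kappa -> G ⊩ ForcedADCom kappa o.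
Proof.
  intros hV hK.
  pintro q U0 x Hx. pintro q1 U1. pintro Hy q2 U2 z. pintro Hz q3 U3 Fzx.
  pintro q4 U4 w Hw. pintro q5 U5 Fwz.
  pex Hx mx. destruct Hx as (Hmx & Kx & _). pose proof (K_V _ _ _ _ _ hK Hmx Kx) as Vx.
  pex Hw mw. destruct Hw as (Hmw & Kw & _). pose proof (K_V _ _ _ _ _ hK Hmw Kw) as Vw.
  pex Hz mz. destruct Hz as (Hmz & Kz & Dz). pose proof (K_V _ _ _ _ _ hK Hmz Kz) as Vz.
  pex Hy y. destruct Hy as [Hy Cov].
  pex Hy m. destruct Hy as (Hm & Ky & _).
  (* the node [r] of the argument: beyond [q5], where [w] is an element of [z], and
     beyond the stages [m] and [mz] from which [y] and [z] are constant *)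
  pose_ex (omega_upper_bound m mz G Hm Hmz) as k Hk. destruct Hk as (Hk & Lm & Lmz).
  pose_ex (omega_upper_bound q5 k G (proj1 U5) Hk) as r Hr. destruct Hr as (Hr & Lq5 & Lk).
  apply (fun A => le_trans _ _ _ _ Hr A Lk) in Lm, Lmz.
  assert (U35 : G ⊩ InUp q3 q5) by (exact (up_trans _ _ _ _ U4 U5)).
  assert (U5r : G ⊩ InUp q5 r) by (split; trivial).
  assert (U3r : G ⊩ InUp q3 r) by (exact (up_trans _ _ _ _ U35 U5r)).
  assert (U2r : G ⊩ InUp q2 r) by (exact (up_trans _ _ _ _ U3 U3r)).
  assert (Dr : G ⊩ ∀ q, InUp r q ⇒ InDom z q).
  { pintro t Ut. apply (mp (proj2 (Dz t))). exact (up_trans _ _ _ _ U2r Ut). }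
  pose proof (mp (Dr r) (up_refl _ _ Hr)) as Vr.
  pose_ex (succ_exists r G) as s S.
  pose_ex (delayed_exists z r s G (V_fun _ _ _ hV Vz) Hr S) as z' D.
  pose proof (delayed_dom _ _ _ _ _ Dr Hr S D) as Dz'.
  (* [y] covers the double complement of [x], to which [z'] belongs *)
  assert (F : G ⊩ FMem r z' y).
  { refine (mp (mp (mp (mp (Cov r) _ z') _ r) _) _).
    - exact (up_trans _ _ _ _ U2 U2r).
    - pexists s. psplits; trivial.
      + exact (in_omega_succ _ _ _ Hr S).
      + apply (delayed_K nu kappa mz z r s); trivial.
    - apply up_refl, Hr.
    - exact (delayed_dense _ _ _ _ _ _ _ _ hV Vx Vz Fzx U3r S D). }
  apply forced_mem_elim in F. pex F z''. pex F v. destruct F as (R & Vy & K).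
  pose proof (restr_self _ _ _ _ (proj1 D) Dz' R) as E. prw E K.
  (* elements of a member of [K^m] are in [K^m] *)
  assert (Kz' : G ⊩ apply_form kappa [m; z']).
  { apply (K_inv _ _ _ _ _ hK Hm) in Ky. pex Ky a. destruct Ky as (Ha & _ & My & _).
    apply (mp (Ha z')). exact (mp (mp (My r v) Vy z') K). }
  pose_ex (restr_exists s w G (V_fun _ _ _ hV Vw)) as ws Rw.
  pose_ex (forced_mem_mono _ _ _ _ _ _ _ hV Vz Fwz
             (up_trans _ _ _ _ U5r (up_succ _ _ _ Hr S)) Rw) as vz Hvz.
  destruct Hvz as [Hvz Kws].
  exact (delayed_not_K _ _ _ _ _ _ _ _ _ _ hK Hm Hr Lm S D Hvz Kws Kz').
Qed.

Theorem theorem6p11 (nu kappa : form)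
  (hV : defines_V nu) (hK : defines_K nu kappa) :
  CZF_proves (K_validates kappa ADCom).
Proof.
  unfold CZF_proves. rewrite <- ren_id. apply den_provable. rewrite K_validates_den.
  pintro o Ho. exact (forced_ADCom nu kappa o _ hV hK).
Qed.
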